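(* Let $\{\mathbf{x}^{(k)}\}_{k\ge 1}$ be the sequence generated by the Pairwise Stochastic Frank-Wolfe algorithm (PSFW, described in the context, with the batch sizes $m^{(i)}=\lceil 1/(1-\kappa)^{2i+2}\rceil$) for solving $\min_{\mathbf{x}\in\mathcal{P}}F(\mathbf{x})$, and let $F^*=\min_{\mathbf{x}\in\mathcal{P}}F(\mathbf{x})$. Then there exist a deterministic constant $C_3$ and a number $\phi$ with $0<\phi<\kappa\le 1/2$ such that $\mathbb{E}\{F(\mathbf{x}^{(k+1)})-F^*\}\le C_3(1-\phi)^{k/(3|V|!+1)}$ for every $k\ge1$, and for some $0<\psi<\phi$, $$\frac{F(\mathbf{x}^{(k)})-F^*}{(1-\psi)^{k/(3|V|!+1)}}\longrightarrow 0\quad\text{almost surely as }k\to\infty.$$ Therefore $F(\mathbf{x}^{(k)})$ converges linearly to $F^*$ almost surely.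
   Context: Problem. $\mathcal{P}=\{\mathbf{x}\in\mathbb{R}^p:\mathbf{C}\mathbf{x}\le\mathbf{d}\}$, with $\mathbf{C}\in\mathbb{R}^{m\times p}$ (rows $\mathbf{C}_i$) and $\mathbf{d}\in\mathbb{R}^m$, is a non-empty compact polyhedron; $V$ is its finite set of vertices ($|V|!$ is the factorial of $|V|$), $D=\sup\{\|\mathbf{x}-\mathbf{y}\|:\mathbf{x},\mathbf{y}\in\mathcal{P}\}$ its diameter. For $i=1,\dots,n$, $f_i:\mathbb{R}^p\to\mathbb{R}$ is strongly convex with parameter $\sigma_i$ and has an $L_i$-Lipschitz continuous gradient. $F=\frac1n\sum_{i=1}^n f_i$, $\sigma_F=\min_i\sigma_i$, $L_F=\max_iL_i$. $\xi$ is uniform on $\{1,\dots,n\}$ and $f(i,\mathbf{x})=f_i(\mathbf{x})$. Constants. $\Omega_{\mathcal{P}}=\zeta_0/\phi_0$, where $\zeta_0=\min\{d_i-\mathbf{C}_i\mathbf{v}:\mathbf{v}\in V,\ i\in\{1,\dots,m\},\ d_i>\mathbf{C}_i\mathbf{v}\}$ and $\phi_0=\max_{i\in\{1,\dots,m\}\setminus I(V)}\|\mathbf{C}_i\|$, with $I(V)=\{i:\mathbf{C}_i\mathbf{v}=d_i\text{ for all }\mathbf{v}\in V\}$. $\kappa=\min\{\frac12,\frac{\Omega_{\mathcal{P}}^2\sigma_F}{8N^2L_FD^2}\}$, where $N=p+1$ if the representation update below uses Carathéodory's theorem and $N=|V|$ otherwise. PSFW. Start from $\mathbf{x}^{(1)}\in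 V$, with weights $\mu^{(1)}_{\mathbf{x}^{(1)}}=1$, $\mu^{(1)}_{\mathbf{v}}=0$ for other $\mathbf{v}\in V$, and $U^{(1)}=\{\mathbf{x}^{(1)}\}$. At iteration $k=1,2,\dots$: (1) Draw $\xi_1,\dots,\xi_{m^{(k)}}$ i.i.d. copies of $\xi$ (independent of the past); set $F^{(k)}(\mathbf{x})=\frac1{m^{(k)}}\sum_{i=1}^{m^{(k)}}f(\xi_i,\mathbf{x})$, $\mathbf{g}^{(k)}=\nabla F^{(k)}(\mathbf{x}^{(k)})$, $L^{(k)}=\frac1{m^{(k)}}\sum_{i=1}^{m^{(k)}}L_{\xi_i}$. (2) Choose a vertex $\mathbf{p}^{(k)}\in\arg\min_{\mathbf{x}\in\mathcal{P}}\langle\mathbf{g}^{(k)},\mathbf{x}\rangle$ and $\mathbf{u}^{(k)}\in\arg\max_{\mathbf{v}\in U^{(k)}}\langle\mathbf{g}^{(k)},\mathbf{v}\rangle$. (3) Set $\mathbf{d}^{(k)}=\mathbf{p}^{(k)}-\mathbf{u}^{(k)}$ and $\gamma^{(k)}_{\max}=\mu^{(k)}_{\mathbf{u}^{(k)}}$. (4) Set $\gamma^{(k)}=\min\{-\langle\mathbf{g}^{(k)},\mathbf{d}^{(k)}\rangle/(L^{(k)}\|\mathbf{d}^{(k)}\|^2),\gamma^{(k)}_{\max}\}$ (with $\gamma^{(k)}=0$ if $\mathbf{d}^{(k)}=0$), or determine it by line search, $\gamma^{(k)}\in\arg\min_{0\le\gamma\le\gamma^{(k)}_{\max}}F^{(k)}(\mathbf{x}^{(k)}+\gamma\mathbf{d}^{(k)})$.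 Set $\mathbf{x}^{(k+1)}=\mathbf{x}^{(k)}+\gamma^{(k)}\mathbf{d}^{(k)}$. (5) Representation update: move weight $\gamma^{(k)}$ from $\mathbf{u}^{(k)}$ to $\mathbf{p}^{(k)}$, i.e. $\mu^{(k+1)}$ equals $\mu^{(k)}$ with $\gamma^{(k)}$ subtracted from the weight of $\mathbf{u}^{(k)}$ and added to the weight of $\mathbf{p}^{(k)}$; $U^{(k+1)}=\{\mathbf{v}\in V:\mu^{(k+1)}_{\mathbf{v}}>0\}$. Optionally, Carathéodory's theorem is then applied to replace this representation $\mathbf{x}^{(k+1)}=\sum_{\mathbf{v}\in U^{(k+1)}}\mu^{(k+1)}_{\mathbf{v}}\mathbf{v}$ by one using a subset of at most $p+1$ of these vertices. ''Converges linearly almost surely'' means that almost surely $F(\mathbf{x}^{(k)})-F^*$ is $o(r^k)$ for some deterministic $r\in(0,1)$. *)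

(* Defs.v *)
From HB Require Import structures.
From mathcomp Require Import all_boot all_order all_algebra finmap.
From mathcomp Require Import all_classical all_reals all_analysis.

Set Implicit Arguments.
Unset Strict Implicit.
Unset Printing Implicit Defensive.

Import Order.TTheory GRing.Theory Num.Theory.
Import numFieldNormedType.Exports.

Local Open Scope classical_set_scope.
Local Open Scope ring_scope.

Section Euclidean.
Context {R : realType} {p : nat}.
Implicit Types (x y v : 'cV[R]_p) (f : 'cV[R]_p -> R).

Definition dotp x y : R := \sum_i x i 0 * y i 0.

(* The library norm of a matrix is the sup norm, hence a separate definition. *)
Definition enorm x : R := Num.sqrt (dotp x x).

Definition gradient f x : 'cV[R]_p := \col_i 'D_(delta_mx i 0) f x.

Definition strongly_convex (sigma : R) f : Prop :=
  0 < sigma /\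
  forall x y (t : R), 0 <= t <= 1 ->
    f (t *: x + (1 - t) *: y) <=
      t * f x + (1 - t) * f y - sigma / 2 * t * (1 - t) * enorm (x - y) ^+ 2.

Definition lipschitz_gradient (L : R) f : Prop :=
  (forall x, differentiable f x) /\
  forall x y, enorm (gradient f x - gradient f y) <= L * enorm (x - y).

Definition extreme_point (A : set 'cV[R]_p) : set 'cV[R]_p :=
  [set v | A v /\ forall y z (t : R), A y -> A z -> 0 < t < 1 ->
    v = t *: y + (1 - t) *: z -> y = z].

Definition diameter (A : set 'cV[R]_p) : R :=
  sup [set r | exists x y, [/\ A x, A y & r = enorm (x - y)]].

End Euclidean.

Section Polyhedron.
Context {R : realType} {m p : nat} (C : 'M[R]_(m, p)) (b : 'cV[R]_m).

Definition polyhedron : set 'cV[R]_p :=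
  [set x | forall i, (C *m x) i 0 <= b i 0].

Lemma finite_extreme_points : finite_set (extreme_point polyhedron).
Proof.
pose tight (v : 'cV[R]_p) : {set 'I_m} := [set i | (C *m v) i 0 == b i 0]%SET.
have inj : {in extreme_point polyhedron &, injective tight}.
  move=> v w; rewrite !inE => -[Pv ev] [Pw _] tvw.
  pose e := v - w; pose c i := (C *m e) i 0.
  have c0 i : (C *m v) i 0 = b i 0 -> c i = 0.
    move=> vi; have : i \in tight w by rewrite -tvw inE vi.
    by rewrite inE /c mulmxBr !mxE => /eqP; rewrite -vi !mxE => ->; rewrite subrr.
  pose h i := if (C *m v) i 0 == b i 0 then 1
              else (b i 0 - (C *m v) i 0) / (1 + `|c i|).
  pose t := \big[Num.min/1]_i h i.
  have c1 i : 0 < 1 + `|c i| by rewrite ltr_pwDl.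
  have t0 : 0 < t.
    rewrite /t; elim/big_rec: _ => // i r _ r0; rewrite lt_min r0 andbT /h.
    case: ifPn => // ni; rewrite divr_gt0 // subr_gt0 lt_neqAle ni.
    exact: Pv.
  have slack i s : `|s| = t -> (C *m v) i 0 + s * c i <= b i 0.
    move=> st; have [vi|vi] := eqVneq ((C *m v) i 0) (b i 0).
      by rewrite c0 // mulr0 addr0 vi.
    rewrite -lerBrDl; apply: le_trans (ler_norm _) _; rewrite normrM st.
    have : t <= h i by rewrite /t (bigD1 i) //= ge_min lexx.
    rewrite /h (negPf vi) ler_pdivlMr //; apply: le_trans.
    by rewrite ler_wpM2l ?(ltW t0) // lerDr.
  have inP s : `|s| = t -> polyhedron (v + s *: e).
    move=> st i; have := slack i s st.
    by rewrite mulmxDr -scalemxAr [X in _ -> X <= _]mxE [X in _ -> _ + X <= _]mxE.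
  have half : 0 < (2^-1 : R) < 1 by rewrite invr_gt0 ltr0n invf_lt1 ?ltr0n // ltr1n.
  have h2 : (1 - 2^-1 : R) = 2^-1 by rewrite {1}(splitr 1) mul1r addrK.
  have := ev (v + t *: e) (v + (- t) *: e) 2^-1.
  rewrite h2 -scalerDr addrACA scaleNr subrr addr0 -mulr2n -(scaler_nat 2 v).
  rewrite scalerA mulVf ?pnatr_eq0 // scale1r -scaleNr => vE.
  have /addrI/eqP : v + t *: e = v + - t *: e.
    by apply: vE => //; apply: inP; rewrite ?normrN gtr0_norm.
  rewrite scaleNr -addr_eq0 -mulr2n -(scaler_nat 2) scalerA scaler_eq0.
  by rewrite mulf_eq0 pnatr_eq0 (gt_eqF t0) /= subr_eq0 => /eqP.
rewrite -(eq_finite_set (inj_card_eq inj)).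
exact: finite_finset.
Qed.

Definition vertices : {fset 'cV[R]_p} := fset_set (extreme_point polyhedron).

(* Minima and maxima over nonempty finite sets of reals are written inf / sup. *)

Definition zeta0 : R :=
  inf [set r | exists v i, [/\ v \in vertices, (C *m v) i 0 < b i 0
                             & r = b i 0 - (C *m v) i 0]].

Definition tight_on_vertices (i : 'I_m) : Prop :=
  forall v, v \in vertices -> (C *m v) i 0 = b i 0.

Definition phi0 : R :=
  sup [set r | exists2 i, ~ tight_on_vertices i & r = enorm (row i C)^T].

Definition Omega : R := zeta0 / phi0.

End Polyhedron.

Section Problem.
Context {R : realType} {n m p : nat}.
Variables (C : 'M[R]_(m, p)) (b : 'cV[R]_m).
Variables (f : 'I_n -> 'cV[R]_p -> R) (sigma L : 'I_n -> R).
(* [carath]: does the representation update use Caratheodory's theorem? *)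
Variable carath : bool.

Definition F (x : 'cV[R]_p) : R := n%:R^-1 * \sum_(i < n) f i x.

Definition Fstar : R := inf [set F x | x in polyhedron C b].

Definition sigmaF : R := inf (range sigma).
Definition LF : R := sup (range L).

Definition Nrep : nat := if carath then p.+1 else #|` vertices C b |.

(* When the polyhedron is a single point, the second term of the minimum has
   denominator 0; it is read as +oo, instead of the value 0 given by x / 0. *)
Definition kappa : R :=
  let D := diameter (polyhedron C b) in
  if D == 0 then 1 / 2
  else Num.min (1 / 2)
         (Omega C b ^+ 2 * sigmaF / (8 * Nrep%:R ^+ 2 * LF * D ^+ 2)).

Definition batch_size (k : nat) : nat :=
  `|Num.ceil (1 / (1 - kappa) ^+ (2 * k + 2))|%N.

(* Weights are functions on the whole space; only their values on the vertices
   are meaningful. *)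
Definition active (mu : 'cV[R]_p -> R) : {fset 'cV[R]_p} :=
  [fset v in vertices C b | 0 < mu v]%fset.

Definition caratheodory_reduction (x : 'cV[R]_p) (mu mu' : 'cV[R]_p -> R) : Prop :=
  [/\ (forall v, v \in vertices C b -> 0 <= mu' v),
      \sum_(v <- vertices C b) mu' v = 1,
      \sum_(v <- vertices C b) mu' v *: v = x,
      (active mu' `<=` active mu)%fset
    & (#|` active mu' | <= p.+1)%N].

Definition representation_update (q u : 'cV[R]_p) (gamma : R) (x' : 'cV[R]_p)
    (mu mu' : 'cV[R]_p -> R) : Prop :=
  let mu1 v := mu v - gamma * (v == u)%:R + gamma * (v == q)%:R in
  if carath then caratheodory_reduction x' mu1 mu'
  else forall v, v \in vertices C b -> mu' v = mu1 v.

Definition stepsize (Fk : 'cV[R]_p -> R) (g : 'cV[R]_p) (Lk gmax : R)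
    (x dir : 'cV[R]_p) (gamma : R) : Prop :=
  gamma = (if dir == 0 then 0
           else Num.min (- dotp g dir / (Lk * enorm dir ^+ 2)) gmax)
  \/ 0 <= gamma <= gmax /\
     forall t, 0 <= t <= gmax -> Fk (x + gamma *: dir) <= Fk (x + t *: dir).

(* One iteration, from the iterate x with weights mu to the iterate x' with
   weights mu', on the sample s 0, ..., s (M - 1). Being a relation, it allows
   every rule for breaking ties, choosing the step size and reducing the
   representation. *)
Definition psfw_step (M : nat) (s : nat -> 'I_n)
    (x : 'cV[R]_p) (mu : 'cV[R]_p -> R) (x' : 'cV[R]_p) (mu' : 'cV[R]_p -> R) :
    Prop :=
  let Fk y := M%:R^-1 * \sum_(j < M) f (s j) y in
  let g := gradient Fk x in
  let Lk := M%:R^-1 * \sum_(j < M) L (s j) in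
  exists (q u : 'cV[R]_p) (gamma : R),
    [/\ q \in vertices C b /\
          (forall y, polyhedron C b y -> dotp g q <= dotp g y),
        u \in active mu /\
          (forall v, v \in active mu -> dotp g v <= dotp g u),
        stepsize Fk g Lk (mu u) x (q - u) gamma,
        x' = x + gamma *: (q - u)
      & representation_update q u gamma x' mu mu'].

Section Probability.
Context {disp : measure_display} {T : measurableType disp} (P : probability T R).

(* Mutual independence of a finite family of sigma-algebras. *)
Definition mutually_independent (I : finType) (S : I -> set (set T)) : Prop :=
  forall (J : {set I}) (A : I -> set T), (forall i, i \in J -> S i (A i)) ->
    P (\bigcap_(i in [set` J]) A i) = (\prod_(i in J) P (A i))%E.

(* The sigma-algebra generated by a finitely-valued random variable. *)
Definition sigma_of (X : T -> 'I_n) : set (set T) :=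
  preimage_set_system [set: T] X [set: set 'I_n].

(* [past k] is the sigma-algebra of everything that happened before the draws
   of iteration k; [xi k j], for j < batch_size k, are those draws. Iterations
   are numbered from 1 and the values at k = 0 are irrelevant. *)
Record psfw (past : nat -> set (set T)) (xi : nat -> nat -> T -> 'I_n)
    (x : nat -> T -> 'cV[R]_p) (mu : nat -> T -> 'cV[R]_p -> R) : Prop := Psfw {
  past_sigma_algebra : forall k, (0 < k)%N -> sigma_algebra [set: T] (past k);
  past_measurable : forall k, (0 < k)%N -> past k `<=` measurable;
  past_increasing : forall k, (0 < k)%N -> past k `<=` past k.+1;
  draws_adapted : forall k j, (0 < k)%N -> (j < batch_size k)%N ->
    sigma_of (xi k j) `<=` past k.+1;
  iterates_adapted : forall k i (B : set R), (0 < k)%N -> measurable B ->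
    past k [set w | B (x k w i 0)];
  weights_adapted : forall k v (B : set R), (0 < k)%N -> v \in vertices C b ->
    measurable B -> past k [set w | B (mu k w v)];
  draws_uniform : forall k j i, (0 < k)%N -> (j < batch_size k)%N ->
    P [set w | xi k j w = i] = (n%:R^-1)%:E;
  draws_independent : forall k, (0 < k)%N ->
    mutually_independent (fun o : option 'I_(batch_size k) =>
      if o is Some j then sigma_of (xi k j) else past k);
  start_iterate : forall w, x 1%N w \in vertices C b;
  start_weights : forall w v, v \in vertices C b ->
    mu 1%N w v = (v == x 1%N w)%:R;
  iteration : forall k w, (0 < k)%N ->
    psfw_step (batch_size k) (fun j => xi k j w)
      (x k w) (mu k w) (x k.+1 w) (mu k.+1 w)
}.

Definition as_linear_convergence (u : nat -> T -> R) (l : R) : Prop :=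
  exists r : R, 0 < r < 1 /\
    {ae P, forall w, (fun k => u k w - l : R) =o_\oo (fun k => r ^+ k : R)}.

End Probability.
End Problem.

(* Main.v *)
(** Since phi may be taken as small as desired, any geometric rate suffices.
    Let h k = F (x k) - F* and let e k be the l^1 distance between the empirical
    distribution of the k-th batch and the uniform one.  The pairwise gap
    <g, u - q> is at least of the order of sqrt (h k), up to O(e k).  Hence,
    unless h k = O(e k), an iteration either contracts h by a constant factor or
    moves the full weight of u to q.  Among |V|^2 + 1 consecutive iterations
    without substantial decrease, the iterates hardly move, so the gradient at
    the first of them strictly orders every exchanged pair (u, q); the sum of
    the ranks of the active vertices in this order then decreases at each
    iteration, whatever the Caratheodory reduction does, which is impossible.
    So h (k + W) <= theta * h k + A * sum_(i < W) e (k + i), with W = |V|^2 + 1.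
    The batches grow geometrically and the draws are pairwise independent, so
    E (e k) = O(q^k) with q = 1 - kappa; for q < s < 1 the random variable
    K = sum_k e k / s^k is integrable, and the recursion yields
    h k <= (c + d * K) * r^k for deterministic c, d and r < 1.  This gives both
    the bound in expectation and the almost sure convergence. *)
Require Import Defs.
From HB Require Import structures.
From mathcomp Require Import all_boot all_order all_algebra finmap.
From mathcomp Require Import all_classical all_reals all_analysis.
From mathcomp Require Import measurable_realfun ring lra.

Set Implicit Arguments.
Unset Strict Implicit.
Unset Printing Implicit Defensive.

Import Order.TTheory GRing.Theory Num.Theory.
Import numFieldNormedType.Exports.

Local Open Scope classical_set_scope.
Local Open Scope ring_scope.

(** * Euclidean geometry and gradients *)

Section EuclideanTheory.
Context {R : realType} {p : nat}.
Implicit Types (x y z v : 'cV[R]_p) (f : 'cV[R]_p -> R).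

Lemma dotpC x y : dotp x y = dotp y x.
Proof. by apply: eq_bigr => i _; rewrite mulrC. Qed.

Lemma dotpDl x y z : dotp (x + y) z = dotp x z + dotp y z.
Proof. by rewrite -big_split; apply: eq_bigr => i _; rewrite mxE mulrDl. Qed.

Lemma dotpZl (a : R) x z : dotp (a *: x) z = a * dotp x z.
Proof. by rewrite mulr_sumr; apply: eq_bigr => i _; rewrite mxE mulrA. Qed.

Lemma dotpNl x z : dotp (- x) z = - dotp x z.
Proof. by rewrite -scaleN1r dotpZl mulN1r. Qed.

Lemma dotpBl x y z : dotp (x - y) z = dotp x z - dotp y z.
Proof. by rewrite dotpDl dotpNl. Qed.

Lemma dotpDr z x y : dotp z (x + y) = dotp z x + dotp z y.
Proof. by rewrite !(dotpC z) dotpDl. Qed.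

Lemma dotpZr z (a : R) x : dotp z (a *: x) = a * dotp z x.
Proof. by rewrite !(dotpC z) dotpZl. Qed.

Lemma dotpNr z x : dotp z (- x) = - dotp z x.
Proof. by rewrite !(dotpC z) dotpNl. Qed.

Lemma dotpBr z x y : dotp z (x - y) = dotp z x - dotp z y.
Proof. by rewrite dotpDr dotpNr. Qed.

Lemma dotp0l z : dotp 0 z = 0.
Proof. by rewrite -(scale0r (0 : 'cV_p)) dotpZl mul0r. Qed.

Lemma dotp_suml (I : Type) (r : seq I) (h : I -> 'cV[R]_p) z :
  dotp (\sum_(i <- r) h i) z = \sum_(i <- r) dotp (h i) z.
Proof.
by elim/big_ind2: _ => [|x a y c <- <-|//]; rewrite ?dotp0l ?dotpDl.
Qed.

Lemma dotp_sumr (I : Type) (r : seq I) (h : I -> 'cV[R]_p) z :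
  dotp z (\sum_(i <- r) h i) = \sum_(i <- r) dotp z (h i).
Proof. by rewrite dotpC dotp_suml; apply: eq_bigr => i _; rewrite dotpC. Qed.

Lemma dotpxx_ge0 x : 0 <= dotp x x.
Proof. by apply: sumr_ge0 => i _; rewrite -expr2 sqr_ge0. Qed.

Lemma dotpxx_eq0 x : (dotp x x == 0) = (x == 0).
Proof.
apply/eqP/eqP => [x0|->]; last by rewrite dotp0l.
apply/colP => i; rewrite mxE; apply/eqP; rewrite -sqrf_eq0 expr2.
apply/eqP; move: i isT; apply: psumr_eq0P x0 => i _.
by rewrite -expr2 sqr_ge0.
Qed.

Lemma enorm_sqr x : enorm x ^+ 2 = dotp x x.
Proof. by rewrite sqr_sqrtr ?dotpxx_ge0. Qed.

Lemma enorm_ge0 x : 0 <= enorm x.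
Proof. exact: sqrtr_ge0. Qed.

Lemma enorm_eq0 x : (enorm x == 0) = (x == 0).
Proof. by rewrite -sqrf_eq0 enorm_sqr dotpxx_eq0. Qed.

Lemma enorm_gt0 x : (0 < enorm x) = (x != 0).
Proof. by rewrite lt_def enorm_ge0 enorm_eq0 andbT. Qed.

Lemma enorm0 : enorm (0 : 'cV[R]_p) = 0.
Proof. by apply/eqP; rewrite enorm_eq0. Qed.

Lemma enormN x : enorm (- x) = enorm x.
Proof. by rewrite /enorm dotpNl dotpNr opprK. Qed.

Lemma enormB x y : enorm (x - y) = enorm (y - x).
Proof. by rewrite -enormN opprB. Qed.

Lemma enormZ (a : R) x : enorm (a *: x) = `|a| * enorm x.
Proof.
rewrite /enorm dotpZl dotpZr mulrA -expr2 sqrtrM ?sqr_ge0 //.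
by rewrite sqrtr_sqr.
Qed.

Lemma dotp_le_norm x y : dotp x y <= enorm x * enorm y.
Proof.
have [->|y0] := eqVneq y 0; first by rewrite dotpC dotp0l enorm0 mulr0.
apply: le_trans (ler_norm _) _.
rewrite -(ler_pXn2r (n := 2)) ?nnegrE ?mulr_ge0 ?enorm_ge0 //.
rewrite exprMn !enorm_sqr -normrX ger0_norm ?sqr_ge0 //.
have y1 : 0 < dotp y y by rewrite -enorm_sqr exprn_gt0 // enorm_gt0.
have := dotpxx_ge0 (dotp y y *: x - dotp x y *: y).
rewrite !(dotpBl, dotpBr, dotpZl, dotpZr) (dotpC y x) => H.
rewrite -subr_ge0 -(pmulr_rge0 _ y1); apply: le_trans H _.
by rewrite le_eqVlt; apply/orP; left; apply/eqP; ring.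
Qed.

Lemma enormD x y : enorm (x + y) <= enorm x + enorm y.
Proof.
rewrite -(ler_pXn2r (n := 2)) ?nnegrE ?addr_ge0 ?enorm_ge0 //.
rewrite sqrrD !enorm_sqr dotpDl !dotpDr (dotpC y x).
have := dotp_le_norm x y; lra.
Qed.

Lemma enorm_le_sum x : enorm x <= \sum_i `|x i 0|.
Proof.
have s0 : 0 <= \sum_i `|x i 0| by apply: sumr_ge0.
rewrite -(ler_pXn2r (n := 2)) ?nnegrE ?enorm_ge0 // enorm_sqr.
rewrite expr2 mulr_suml; apply: ler_sum => i _.
apply: le_trans (ler_norm _) _; rewrite normrM ler_wpM2l //.
by rewrite (bigD1 i) //= lerDl sumr_ge0.
Qed.

Lemma is_derive_gradient f x z : differentiable f x ->
  is_derive x z f (dotp (gradient f x) z).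
Proof.
move=> df; split; first exact: diff_derivable.
rewrite deriveE // {1}(_ : z = \sum_i z i 0 *: delta_mx i 0); last first.
  rewrite [LHS]matrix_sum_delta; apply: eq_bigr => i _.
  by rewrite big_ord1.
rewrite linear_sum; apply: eq_bigr => i _.
by rewrite linearZ /= mxE deriveE // mulrC.
Qed.

(** Divide the convexity inequality on the segment from [x] to [y] by [h] and let [h] decrease to 0.
    The limit is taken by contradiction: [e] is the deficit, half of which absorbs the error of the
    difference quotient and half the term [h * q]. *)
Lemma strongly_convex_gradient (s : R) f x y :
  strongly_convex s f -> differentiable f x ->
  f x + dotp (gradient f x) (y - x) + s / 2 * enorm (y - x) ^+ 2 <= f y.
Proof.
move=> [s0 sc] df.
have [dz Dz] := is_derive_gradient (y - x) df.
set q := s / 2 * _; rewrite leNgt; apply/negP => lt_fy.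
set a := dotp _ _ in Dz lt_fy; pose e := f x + a + q - f y.
have e0 : 0 < e by rewrite /e; lra.
have q0 : 0 <= q by rewrite mulr_ge0 ?sqr_ge0 // ltW // divr_gt0.
have cz : (fun h : R => h^-1 *: ((f \o shift x) (h *: (y - x)) - f x))
    @ 0^'+ --> a by apply: cvg_dnbhs_at_right; rewrite -Dz; exact: dz.
near (0 : R)^'+ => h.
have h0 : 0 < h by near: h; exact: nbhs_right_gt.
have h1 : h < 1 by near: h; exact: nbhs_right_lt.
have hq : h * (2 * q + 1) < e.
  rewrite -ltr_pdivlMr; last by lra.
  by near: h; apply: nbhs_right_lt; rewrite divr_gt0 //; lra.
have : a - e / 2 < h^-1 *: ((f \o shift x) (h *: (y - x)) - f x).
  by near: h; apply: (cvgr_gt _ cz); lra.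
rewrite /= /GRing.scale /= ltr_pdivlMl //.
have := sc y x h; rewrite (ltW h0) (ltW h1) => /(_ isT).
have -> : h *: y + (1 - h) *: x = h *: (y - x) + x.
  by rewrite scalerBr scalerBl scale1r addrA addrAC.
have -> : s / 2 * h * (1 - h) * enorm (y - x) ^+ 2 = h * (1 - h) * q.
  by rewrite /q; ring.
move=> le1 lt1.
have : h * (a - e / 2) < h * (f y - f x - (1 - h) * q) by nra.
rewrite ltr_pM2l // => lt2.
have : h * q < e / 2 by nra.
rewrite /e in lt2 *; nra.
Unshelve. all: by end_near. Qed.

End EuclideanTheory.

(** * The pairwise gap on a polyhedron *)

(** Serves for the slacks in [zeta0] and for the parameters [sigma], both finite families. *)
Lemma positive_lower_bound (R : realFieldType) (I : eqType) (r : seq I)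
    (h : I -> R) :
  exists2 e : R, 0 < e & forall i, i \in r -> 0 < h i -> e <= h i.
Proof.
elim: r => [|i r [e e0 eP]]; first by exists 1.
exists (if 0 < h i then Num.min e (h i) else e).
  by case: ifP => // hi; rewrite lt_min e0.
move=> j; rewrite inE => /predU1P[->|jr] hj; first by rewrite hj ge_min lexx orbT.
by case: ifP => _; rewrite ?ge_min eP.
Qed.

Section PolyhedronTheory.
Context {R : realType} {m p : nat} (C : 'M[R]_(m, p)) (b : 'cV[R]_m).
Implicit Types (x y z v g q u : 'cV[R]_p) (mu : 'cV[R]_p -> R).

Definition convex_rep x mu : Prop :=
  [/\ (forall v, v \in vertices C b -> 0 <= mu v),
      \sum_(v <- vertices C b) mu v = 1
    & \sum_(v <- vertices C b) mu v *: v = x].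

Lemma vertices_sub v : v \in vertices C b -> polyhedron C b v.
Proof.
by rewrite in_fset_set ?inE; [case | exact: finite_extreme_points].
Qed.

Lemma mulmx_dotp z i : (C *m z) i 0 = dotp (row i C)^T z.
Proof. by rewrite mxE; apply: eq_bigr => j _; rewrite !mxE. Qed.

Lemma slack_ge0 v i : v \in vertices C b -> 0 <= b i 0 - (C *m v) i 0.
Proof. by move=> /vertices_sub Pv; rewrite subr_ge0; exact: Pv. Qed.

(** By Cauchy-Schwarz, [K] need only exceed the ratio of row norm to slack for every slack pair; the
    sum of all these ratios does. Tight pairs add 0 to it, since [x / 0 = 0]. *)
Lemma slack_scale : exists2 K : R, 0 < K & forall v i z, v \in vertices C b ->
  (C *m v) i 0 < b i 0 ->
  (C *m z) i 0 <= K * enorm z * (b i 0 - (C *m v) i 0).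
Proof.
pose h i v := enorm (row i C)^T / (b i 0 - (C *m v) i 0).
have h0 i v : v \in vertices C b -> 0 <= h i v.
  by move=> vV; rewrite divr_ge0 ?enorm_ge0 ?slack_ge0.
have hs0 i : 0 <= \sum_(v <- vertices C b) h i v.
  by rewrite big_seq sumr_ge0 // => v; exact: h0.
exists (1 + \sum_i \sum_(v <- vertices C b) h i v).
  by rewrite ltr_pwDl // sumr_ge0.
move=> v i z vV sl; rewrite mulmx_dotp; apply: le_trans (dotp_le_norm _ _) _.
rewrite -subr_gt0 in sl; rewrite mulrAC ler_wpM2r ?enorm_ge0 //.
rewrite -ler_pdivrMr //; apply: ler_wpDl => //.
rewrite (bigD1 i) //= ler_wpDr ?sumr_ge0 //.
rewrite (big_fsetD1 v) //= lerDl big_seq sumr_ge0 // => w.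
by rewrite !inE => /andP[_]; exact: h0.
Qed.

Lemma convex_rep_mem x mu : convex_rep x mu -> polyhedron C b x.
Proof.
move=> [mu0 mu1 <-] i; rewrite mulmx_sumr summxE.
rewrite -[leRHS]mul1r -mu1 mulr_suml big_seq [leRHS]big_seq.
apply: ler_sum => v vV; rewrite -scalemxAr mxE ler_wpM2l ?mu0 //.
exact: vertices_sub.
Qed.

Lemma convex_rep_active x mu : convex_rep x mu -> exists v, v \in active C b mu.
Proof.
move=> [mu0 mu1 _]; apply: contrapT => nv.
have : \sum_(v <- vertices C b) mu v = 0.
  rewrite big_seq big1 // => v vV; apply/eqP; rewrite eq_le mu0 // andbT leNgt.
  by apply/negP => muv; apply: nv; exists v; rewrite !inE vV.
by rewrite mu1 => /eqP; rewrite oner_eq0.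
Qed.

Lemma pairwise_gap_ge0 x mu g q u : convex_rep x mu ->
  (forall y, polyhedron C b y -> dotp g q <= dotp g y) ->
  (forall v, v \in active C b mu -> dotp g v <= dotp g u) ->
  0 <= dotp g (u - q).
Proof.
move=> /convex_rep_active[v va] qmin umax.
rewrite dotpBr subr_ge0; apply: le_trans (umax _ va); apply: qmin.
by apply: vertices_sub; move: va; rewrite !inE => /andP[].
Qed.

(* Removing from each weight at most the amount T, chosen proportional to
   |x - y|, leaves room for y: the vector y - x + sum_v t_v v lies in
   s P, where s = sum_v t_v.  Indeed, a constraint that is slack at some vertex
   of weight >= T gains enough slack from it, and otherwise all the slack of x
   in this constraint is available. *)
Lemma pairwise_gap : exists2 K : R, 0 < K & forall x mu g q u y,
  convex_rep x mu -> polyhedron C b y ->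
  (forall y, polyhedron C b y -> dotp g q <= dotp g y) ->
  (forall v, v \in active C b mu -> dotp g v <= dotp g u) ->
  dotp g (x - y) <= K * dotp g (u - q) * enorm (x - y).
Proof.
have [K0 K0gt KP] := slack_scale.
exists ((1 + #|` vertices C b|%:R) * K0) => [|x mu g q u y rx Py qmin umax].
  by rewrite mulr_gt0 // ltr_pwDl.
have gap0 := pairwise_gap_ge0 rx qmin umax.
have [->|xy] := eqVneq x y; first by rewrite subrr enorm0 mulr0 dotpC dotp0l.
have [mu0 mu1 mux] := rx.
pose T := K0 * enorm (x - y).
have T0 : 0 < T by rewrite mulr_gt0 // enorm_gt0 subr_eq0.
pose t v := Num.min (mu v) T.
have t0 v : v \in vertices C b -> 0 <= t v.
  by move=> vV; rewrite le_min mu0 // ltW.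
pose s := \sum_(v <- vertices C b) t v.
pose w := y - x + \sum_(v <- vertices C b) t v *: v.
have s0 : 0 < s.
  have [v] := convex_rep_active rx; rewrite !inE /= => /andP[vV muv].
  rewrite /s (big_fsetD1 v) //= ltr_pwDl ?lt_min ?muv // big_seq sumr_ge0 //.
  by move=> u'; rewrite !inE => /andP[_]; exact: t0.
have Pw : polyhedron C b (s^-1 *: w).
  move=> i; rewrite -scalemxAr mxE ler_pdivrMl // mulmxDr mulmxBr.
  rewrite [leLHS]mxE [X in X + _]mxE [X in _ + X + _]mxE mulmx_sumr summxE.
  rewrite /s mulr_suml -lerBrDr -sumrB.
  under eq_bigr do rewrite -scalemxAr [X in _ - X]mxE -mulrBr.
  have [[v [vV slv muv]]|nv] := pselect (exists v, [/\ v \in vertices C b,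
      (C *m v) i 0 < b i 0 & T <= mu v]).
    have -> : (C *m y) i 0 - (C *m x) i 0 = (C *m (y - x)) i 0.
      by rewrite mulmxBr [RHS]mxE [X in _ = _ + X]mxE.
    apply: le_trans (KP _ _ _ vV slv) _.
    rewrite enormB -/T (big_fsetD1 v) //= /t (min_r muv) lerDl.
    rewrite big_seq sumr_ge0 // => u'; rewrite !inE => /andP[_ uV].
    by rewrite mulr_ge0 ?slack_ge0 //; exact: t0.
  have -> : \sum_(v <- vertices C b) t v * (b i 0 - (C *m v) i 0) =
      \sum_(v <- vertices C b) mu v * (b i 0 - (C *m v) i 0).
    apply: eq_big_seq => v vV; have := slack_ge0 i vV.
    rewrite le_eqVlt => /predU1P[<-|slv]; first by rewrite !mulr0.
    rewrite /t min_l // leNgt; apply/negP => muv; apply: nv.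
    by exists v; split => //; [rewrite -subr_gt0 | exact: ltW].
  under [leRHS]eq_bigr do rewrite mulrBr.
  rewrite sumrB -mulr_suml mu1 mul1r.
  have -> : \sum_(v <- vertices C b) mu v * (C *m v) i 0 = (C *m x) i 0.
    rewrite -mux mulmx_sumr summxE; apply: eq_bigr => v _.
    by rewrite -scalemxAr [RHS]mxE.
  by rewrite lerB //; exact: Py.
have gw : s * dotp g q <= dotp g w.
  by have := qmin _ Pw; rewrite dotpZr ler_pdivlMl.
have -> : dotp g (x - y) = \sum_(v <- vertices C b) t v * dotp g v - dotp g w.
  rewrite /w [in RHS]dotpDr dotp_sumr -(opprB x y) dotpNr.
  under [X in _ = _ - (_ + X)]eq_bigr do rewrite dotpZr.
  ring.
(* A vertex with [t v > 0] is active, hence has value at most that of [u]; afterwards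
   [s <= #|V| * T] produces the constant. *)
apply: (@le_trans _ _ (s * dotp g (u - q))).
  rewrite dotpBr mulrBr; apply: lerB => //.
  rewrite /s mulr_suml big_seq [leRHS]big_seq; apply: ler_sum => v vV.
  have := mu0 v vV; rewrite le_eqVlt => /predU1P[v0|v0].
    by rewrite /t -v0 min_l ?mul0r // ltW.
  by rewrite ler_wpM2l ?t0 // umax // !inE vV.
rewrite [leRHS]mulrAC ler_wpM2r //.
apply: (@le_trans _ _ (#|` vertices C b|%:R * T)).
  rewrite /s cardfE -sum1_card natr_sum big_distrl /= big_seq_fsetE /=.
  by apply: ler_sum => v _; rewrite mul1r ge_min lexx orbT.
by rewrite /T mulrA ler_wpM2r ?enorm_ge0 // mulrDl mul1r lerDr ltW.
Qed.

(** * Compactness: the diameter and the positivity of [Omega] *)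

Hypothesis cP : compact (polyhedron C b).

Lemma has_sup_distances : polyhedron C b !=set0 ->
  has_sup [set r | exists x y, [/\ polyhedron C b x, polyhedron C b y
                                & r = enorm (x - y)]].
Proof.
move=> [x0 Px0]; split; first by exists (enorm (x0 - x0)), x0, x0.
have [M [_ PM]] := compact_bounded cP.
have bd x i : polyhedron C b x -> `|x i 0| <= M + 1.
  move=> Px; apply: le_trans (PM (M + 1) _ x Px); last by rewrite ltrDl.
  rewrite [leRHS]/Num.norm /= mx_normrE.
  by apply/bigmax_geP; right => /=; exists (i, 0).
exists (\sum_(i < p) (M + 1 + (M + 1))) => _ [x [y [Px Py ->]]].
apply: le_trans (enorm_le_sum _) _; apply: ler_sum => i _.
rewrite !mxE; apply: le_trans (ler_normB _ _) _.
by rewrite lerD ?bd.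
Qed.

Lemma enorm_le_diameter x y : polyhedron C b x -> polyhedron C b y ->
  enorm (x - y) <= diameter (polyhedron C b).
Proof.
move=> Px Py; apply: ub_le_sup; last by exists x, y.
by have [] : has_sup _ := has_sup_distances (ex_intro _ x Px).
Qed.

Lemma polyhedron_no_ray v z :
  (forall t, 0 <= t -> polyhedron C b (v + t *: z)) -> z = 0.
Proof.
move=> ray; apply/eqP; rewrite -enorm_eq0 eq_le enorm_ge0 andbT leNgt.
apply/negP => z0; pose D := diameter (polyhedron C b).
have Pv : polyhedron C b v by rewrite -[v]addr0 -(scale0r z); exact: ray.
have D0 : 0 <= D.
  by rewrite -(enorm0 (R := R) (p := p)) -(subrr v) enorm_le_diameter.
have t0 : 0 <= (D + 1) / enorm z by rewrite divr_ge0 ?enorm_ge0 // addr_ge0.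
have := enorm_le_diameter (ray _ t0) Pv.
rewrite addrAC subrr add0r enormZ ger0_norm // divfK ?gt_eqF // -/D.
by rewrite gerDl ler10.
Qed.

(** If every row that is slack at some vertex vanished, then for each [z] of the polyhedron the
    whole ray from [v] through [z] would stay inside: rows tight at [v] do not increase along it,
    and the others are constant. Compactness then forces [z = v]. *)
Lemma exists_slack v x y : v \in vertices C b ->
  polyhedron C b x -> polyhedron C b y -> x != y ->
  exists i w, [/\ w \in vertices C b, (C *m w) i 0 < b i 0
                 & 0 < enorm (row i C)^T].
Proof.
move=> vV Px Py xy; apply: contrapT => ns.
have eqv z : polyhedron C b z -> z = v.
  move=> Pz; apply/eqP; rewrite -subr_eq0; apply/eqP.
  apply: (@polyhedron_no_ray v) => t t0 i.
  rewrite mulmxDr -scalemxAr [leLHS]mxE [X in _ + X]mxE.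
  have := slack_ge0 i vV; rewrite subr_ge0 le_eqVlt => /predU1P[tv|sl].
    rewrite tv gerDl mulr_ge0_le0 // mulmxBr [leLHS]mxE [X in _ + X]mxE tv.
    by rewrite subr_le0; exact: Pz.
  have r0 : (row i C)^T = 0.
    apply/eqP; apply: contrapT => /negP; rewrite -enorm_gt0 => r0.
    by apply: ns; exists i, v.
  by rewrite (mulmx_dotp (z - v)) r0 dotp0l mulr0 addr0 ltW.
by move: xy; rewrite (eqv x) // (eqv y) // eqxx.
Qed.

(** The row given by [exists_slack] makes the sets in [zeta0] and [phi0] nonempty, since a row slack
    at [w] is not tight on all vertices; so neither [inf] nor [sup] falls back to the default value
    0. *)
Lemma Omega_gt0 v x y : v \in vertices C b ->
  polyhedron C b x -> polyhedron C b y -> x != y -> 0 < Omega C b.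
Proof.
move=> vV Px Py xy; have [i [w [wV slw nw]]] := exists_slack vV Px Py xy.
apply: divr_gt0.
  pose h (vi : 'cV[R]_p * 'I_m) := b vi.2 0 - (C *m vi.1) vi.2 0.
  have [e e0 eP] := positive_lower_bound
    [seq (v, i) | v <- vertices C b, i <- enum 'I_m] h.
  have {}eP v' j : v' \in vertices C b -> (C *m v') j 0 < b j 0 -> e <= h (v', j).
    move=> vV'; rewrite -subr_gt0 => slv; apply: eP => //.
    by apply: allpairs_f; rewrite ?mem_enum.
  apply: lt_le_trans e0 _; apply: lb_le_inf; first by exists (h (w, i)), w, i.
  by move=> _ [v' [j [vV' slv ->]]]; exact: eP.
apply: lt_le_trans nw _; apply: ub_le_sup; last first.
  by exists i => // /(_ _ wV) tw; rewrite tw ltxx in slw.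
exists (\sum_j enorm (row j C)^T) => _ [j _ ->].
by rewrite (bigD1 j) //= lerDl sumr_ge0 // => k _; exact: enorm_ge0.
Qed.

End PolyhedronTheory.

(** * One iteration *)

Section SmoothStronglyConvex.
Context {R : realType} {p : nat}.
Implicit Types (x y z : 'cV[R]_p) (f : 'cV[R]_p -> R).

Lemma strongly_convex_ge_tangent (s : R) f x y :
  strongly_convex s f -> differentiable f x ->
  f x + dotp (gradient f x) (y - x) <= f y.
Proof.
move=> sc df; have := strongly_convex_gradient y sc df.
have [s0 _] := sc; have : 0 <= s / 2 * enorm (y - x) ^+ 2.
  by rewrite mulr_ge0 ?sqr_ge0 // ltW // divr_gt0.
lra.
Qed.

(* The classical constant is L / 2 instead of 3 L / 4, but any constant < L
   suffices, and convexity yields this one without integration, by going from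
   y to y + z in two halves. *)
Lemma smooth_descent (s l : R) f y z :
  strongly_convex s f -> lipschitz_gradient l f ->
  f (y + z) <= f y + dotp (gradient f y) z + 3 / 4 * l * enorm z ^+ 2.
Proof.
move=> sc [df lg].
have tangent t t' : f (y + t *: z) <= f (y + t' *: z) +
    (t - t') * dotp (gradient f (y + t *: z)) z.
  have := strongly_convex_ge_tangent (y + t' *: z) sc (df (y + t *: z)).
  by rewrite opprD addrACA subrr add0r -scalerBl dotpZr; lra.
have curv t : 0 <= t -> dotp (gradient f (y + t *: z)) z <=
    dotp (gradient f y) z + t * l * enorm z ^+ 2.
  move=> t0; rewrite -lerBlDl -dotpBl; apply: le_trans (dotp_le_norm _ _) _.
  rewrite expr2 mulrA ler_wpM2r ?enorm_ge0 //.
  apply: le_trans (lg _ _) _.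
  by rewrite addrAC subrr add0r enormZ ger0_norm // mulrCA mulrA.
have := tangent 1 (1 / 2); have := tangent (1 / 2) 0.
rewrite scale0r addr0 scale1r.
have := curv 1 ler01; rewrite scale1r.
have half0 : 0 <= 1 / 2 :> R by lra.
by have := curv _ half0; lra.
Qed.

(** Adding the first-order inequalities at [x] and [y] squeezes the inner product of the gradient
    and point differences between [s * r ^+ 2] and [l * r ^+ 2]. It makes every [L i] positive once
    there are two distinct points. *)
Lemma strongly_convex_le_lipschitz (s l : R) f x y : x != y ->
  strongly_convex s f -> lipschitz_gradient l f -> s <= l.
Proof.
move=> xy sc [df lg].
have := strongly_convex_gradient y sc (df x).
have := strongly_convex_gradient x sc (df y).
have := lg x y; set r := enorm (x - y) => lxy.
have r0 : 0 < r by rewrite enorm_gt0 subr_eq0.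
rewrite -/r (enormB y x) -/r => sx sy.
have : dotp (gradient f x - gradient f y) (x - y) <= l * r * r.
  apply: le_trans (dotp_le_norm _ _) _.
  by rewrite -/r ler_wpM2r // ltW.
rewrite dotpBl -(opprB x y) dotpNr in sy * => lxy2.
by rewrite -(ler_pM2r (x := r ^+ 2)) ?exprn_gt0 //; nra.
Qed.

End SmoothStronglyConvex.

(** * Weighted averages of the components *)

Section WeightedAverages.
Context {R : realType} {n p : nat}.
Variables (f : 'I_n -> 'cV[R]_p -> R) (sigma L : 'I_n -> R).
Hypothesis sc : forall i, strongly_convex (sigma i) (f i).
Hypothesis lg : forall i, lipschitz_gradient (L i) (f i).
Implicit Types (w : 'I_n -> R) (x y z : 'cV[R]_p).

(** Both [F] (uniform weights) and the batch averages (weights [freq]) have this form, so sampling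
    errors are measured by the l^1 distance between weights. *)
Definition wavg w y : R := \sum_i w i * f i y.

Lemma gradient_wavg w x : gradient (wavg w) x = \sum_i w i *: gradient (f i) x.
Proof.
apply/colP => j; rewrite mxE summxE.
have dw : is_derive x (delta_mx j 0) (\sum_(i < n) w i \*: f i)
    (\sum_(i < n) w i *: (gradient (f i) x) j 0).
  apply: is_derive_sum => i; apply: is_deriveZ; rewrite mxE.
  by split => //; apply: diff_derivable; case: (lg i).
have -> : wavg w = \sum_(i < n) w i \*: f i.
  by apply/funext => y; rewrite fct_sumE.
by rewrite derive_val; apply: eq_bigr => i _; rewrite [RHS]mxE.
Qed.

Lemma dotp_gradient_wavg w x z :
  dotp (gradient (wavg w) x) z = \sum_i w i * dotp (gradient (f i) x) z.
Proof.
by rewrite gradient_wavg dotp_suml; apply: eq_bigr => i _; rewrite dotpZl.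
Qed.

Lemma wavg_convex (s : R) w x y : (forall i, 0 <= w i) -> \sum_i w i = 1 ->
  (forall i, s <= sigma i) ->
  wavg w x + dotp (gradient (wavg w) x) (y - x) + s / 2 * enorm (y - x) ^+ 2
    <= wavg w y.
Proof.
move=> w0 w1 ss; set q := s / 2 * _.
have -> : q = \sum_i w i * q by rewrite -mulr_suml w1 mul1r.
rewrite dotp_gradient_wavg -!big_split /=; apply: ler_sum => i _.
rewrite -!mulrDr ler_wpM2l //.
have [df _] := lg i; apply: le_trans (strongly_convex_gradient y (sc i) (df x)).
by rewrite lerD2l ler_wpM2r ?sqr_ge0 // ler_wpM2r // invr_ge0.
Qed.

Lemma wavg_descent w y z : (forall i, 0 <= w i) ->
  wavg w (y + z) <= wavg w y + dotp (gradient (wavg w) y) z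
    + 3 / 4 * (\sum_i w i * L i) * enorm z ^+ 2.
Proof.
move=> w0.
have -> : 3 / 4 * (\sum_i w i * L i) * enorm z ^+ 2 =
    \sum_i w i * (3 / 4 * L i * enorm z ^+ 2).
  by rewrite mulr_sumr mulr_suml; apply: eq_bigr => i _; ring.
rewrite dotp_gradient_wavg -!big_split /=; apply: ler_sum => i _.
rewrite -!mulrDr ler_wpM2l //.
exact: smooth_descent (sc i) (lg i).
Qed.

Lemma wavg_lipschitz_gradient w x y z : (forall i, 0 <= w i) ->
  dotp (gradient (wavg w) x) z <=
    dotp (gradient (wavg w) y) z + (\sum_i w i * L i) * enorm (x - y) * enorm z.
Proof.
move=> w0; rewrite !dotp_gradient_wavg -mulrA mulr_suml.
rewrite -big_split /=; apply: ler_sum => i _.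
rewrite -[w i * L i * _]mulrA -mulrDr ler_wpM2l // -lerBlDl -dotpBl.
apply: le_trans (dotp_le_norm _ _) _; rewrite mulrA ler_wpM2r ?enorm_ge0 //.
by have [_] := lg i.
Qed.

Variables (P : set 'cV[R]_p) (B : R).
Hypothesis gradB : forall i y, P y -> enorm (gradient (f i) y) <= B.

Lemma wavg_dist w w' x z : P x ->
  dotp (gradient (wavg w) x) z <= dotp (gradient (wavg w') x) z
    + (\sum_i `|w i - w' i|) * B * enorm z.
Proof.
move=> Px; rewrite !dotp_gradient_wavg -!mulrA mulr_suml.
rewrite -big_split /=; apply: ler_sum => i _.
rewrite -lerBlDl -mulrBl; apply: le_trans (ler_norm _) _.
have bd u : dotp (gradient (f i) x) u <= B * enorm u.
  by apply: le_trans (dotp_le_norm _ _) _; rewrite ler_wpM2r ?enorm_ge0 ?gradB.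
rewrite normrM ler_wpM2l // ler_norml lerNl -dotpNr bd andbT.
by rewrite -(enormN z) bd.
Qed.

(** Convexity bounds [f i u - f i v] by the slope of the tangent at [u]; taken in both orders, this
    uses the gradients at the two endpoints only. *)
Lemma component_lipschitz i x y : P x -> P y ->
  `|f i x - f i y| <= B * enorm (x - y).
Proof.
have half u v : P u -> f i u - f i v <= B * enorm (u - v).
  move=> Pu; have [df _] := lg i.
  have := strongly_convex_ge_tangent v (sc i) (df u).
  rewrite -(opprB u v) dotpNr => h.
  apply: (@le_trans _ _ (dotp (gradient (f i) u) (u - v))).
    lra.
  by apply: le_trans (dotp_le_norm _ _) _; rewrite ler_wpM2r ?enorm_ge0 ?gradB.
move=> Px Py; rewrite ler_norml lerNl opprB half // andbT.
by rewrite enormB half.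
Qed.

Lemma wavg_diff w w' x y : P x -> P y ->
  wavg w x - wavg w y <= wavg w' x - wavg w' y
    + (\sum_i `|w i - w' i|) * B * enorm (x - y).
Proof.
move=> Px Py; rewrite -!mulrA mulr_suml -!sumrB -big_split /=.
apply: ler_sum => i _; rewrite -!mulrBr -lerBlDl -mulrBl.
apply: le_trans (ler_norm _) _.
by rewrite normrM ler_wpM2l // component_lipschitz.
Qed.

End WeightedAverages.

(** * Decrease and length of a step *)

Section StepSize.
Context {R : realType} {p : nat}.
Variables (Phi : 'cV[R]_p -> R) (s l : R).
Hypotheses (s0 : 0 < s) (l0 : 0 < l).
Hypothesis conv : forall x y,
  Phi x + dotp (gradient Phi x) (y - x) + s / 2 * enorm (y - x) ^+ 2 <= Phi y.
Hypothesis desc : forall y z,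
  Phi (y + z) <= Phi y + dotp (gradient Phi y) z + 3 / 4 * l * enorm z ^+ 2.
Hypothesis lip : forall x y z, dotp (gradient Phi x) z <=
  dotp (gradient Phi y) z + l * enorm (x - y) * enorm z.

Variables (x d : 'cV[R]_p) (M gam : R).
Let a := - dotp (gradient Phi x) d.
Hypothesis step : stepsize Phi (gradient Phi x) l M x d gam.

(** Up to the step [a / (l * enorm d ^+ 2)], the quadratic term of [desc] costs at most three
    quarters of the linear decrease. *)
Let ray_descent (t : R) : 0 <= t -> t * (l * enorm d ^+ 2) <= a ->
  Phi (x + t *: d) <= Phi x - t * a / 4.
Proof.
move=> t0 ta; have := desc x (t *: d).
rewrite dotpZr enormZ exprMn ger0_norm //.
rewrite -[dotp _ _]opprK -/a; have : t * (t * (l * enorm d ^+ 2)) <= t * a.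
  by rewrite ler_wpM2l.
lra.
Qed.

Lemma stepsize_range : 0 <= a -> 0 <= M ->
  [/\ 0 <= gam, gam <= M & Phi (x + gam *: d) <= Phi x].
Proof.
move=> a0 M0; case: step => [->|[/andP[g0 gM] min_gam]]; last first.
  by split=> //; have := min_gam 0; rewrite scale0r addr0; apply; rewrite lexx M0.
case: ifPn => [_|d0]; first by rewrite scale0r addr0.
have ld : 0 < l * enorm d ^+ 2 by rewrite mulr_gt0 // exprn_gt0 // enorm_gt0.
rewrite -/a; set t := Num.min _ _.
have t0 : 0 <= t by rewrite le_min M0 andbT divr_ge0 // ltW.
split=> //; first by rewrite ge_min lexx orbT.
apply: le_trans (ray_descent t0 _) _.
  by rewrite -ler_pdivlMr // ge_min lexx.
by rewrite gerBl divr_ge0 // mulr_ge0.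
Qed.

(** Here [eta] is the unclipped step of the formula and [gam1] the clipped one. A line search
    decreases [Phi] at least as much as [gam1] does; its length is compared with [gam1] because the
    cost of the noise is proportional to [gam]. *)
Lemma stepsize_progress : 0 < a -> 0 < M ->
  let eta := a / (l * enorm d ^+ 2) in let gam1 := Num.min eta M in
  [/\ gam <= (1 + 2 * l / s) * gam1,
      Phi (x + gam *: d) <= Phi x - gam1 * a / 4
    & M < eta -> gam = M].
Proof.
move=> a0 M0 eta gam1.
have xd t : x + t *: d - x = t *: d by rewrite addrAC subrr add0r.
have d0 : d != 0.
  by apply: contraTneq a0 => d0; rewrite /a d0 dotpC dotp0l oppr0 ltxx.
have N0 : 0 < enorm d ^+ 2 by rewrite exprn_gt0 // enorm_gt0.
have ld : 0 < l * enorm d ^+ 2 by rewrite mulr_gt0.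
have eta0 : 0 < eta by rewrite divr_gt0.
have gam10 : 0 < gam1 by rewrite lt_min eta0.
have rho1 : 0 < 2 * l / s by rewrite divr_gt0 // mulr_gt0.
have desc1 : Phi (x + gam1 *: d) <= Phi x - gam1 * a / 4.
  by apply: ray_descent; [exact: ltW | rewrite -ler_pdivlMr // ge_min lexx].
case: step => [|[/andP[g0 gM] min_gam]].
  rewrite (negPf d0) -/a -/eta -/gam1 => ->; split=> //.
    by rewrite ler_peMl ?ltW // ltrDl.
  by move=> Meta; rewrite /gam1 min_r // ltW.
have fg : Phi (x + gam *: d) <= Phi (x + gam1 *: d).
  by apply: min_gam; rewrite ltW //= ge_min lexx orbT.
split; [|exact: le_trans fg desc1|].
- have [gam00|gam00] := eqVneq gam 0.
    by rewrite gam00 mulr_ge0 ?ltW // ltr_wpDl // ltW.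
  have gam_gt0 : 0 < gam by rewrite lt_def gam00.
  (* As the value does not rise above [Phi x], strong convexity leaves
     [s / 2 * gam * enorm d ^+ 2 <= a], that is [gam <= 2 * l / s * eta]. When [gam1 = M], the bound
     [gam <= M] suffices. *)
  have := conv x (x + gam *: d); rewrite xd dotpZr enormZ exprMn.
  rewrite (ger0_norm g0) -[dotp _ _]opprK -/a => cv.
  have : gam * (s / 2 * gam * enorm d ^+ 2) <= gam * a.
    have : 0 <= gam1 * a by rewrite mulr_ge0 ?ltW.
    lra.
  rewrite ler_pM2l // => ga.
  have : gam <= 2 * l / s * eta.
    have -> : 2 * l / s * eta = a / (s / 2 * enorm d ^+ 2).
      by rewrite /eta; field; rewrite !gt_eqF // enorm_gt0.
    have sN : 0 < s / 2 * enorm d ^+ 2 by rewrite mulr_gt0 // divr_gt0.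
    by rewrite ler_pdivlMr //; lra.
  rewrite /gam1; case: (leP eta M) => _ ge; first by rewrite mulrDl mul1r; nra.
  by nra.
(* If the search stopped before [M], the slope there would be at most [- a + gam * (l * N)], and
   going on to [M] would decrease [Phi] further, because [M * (l * N) < a] and 3/4 is below 1. *)
- move=> Meta; apply/eqP; rewrite eq_le gM leNgt; apply/negP => gltM.
  have := min_gam M; rewrite ltW //= lexx => /(_ isT).
  have -> : x + M *: d = (x + gam *: d) + (M - gam) *: d.
    by rewrite -addrA -scalerDl subrKC.
  apply/negP; rewrite -ltNge; apply: le_lt_trans (desc _ _) _.
  rewrite dotpZr enormZ exprMn ger0_norm ?subr_ge0 //.
  have := lip (x + gam *: d) x d; rewrite xd enormZ ger0_norm //.
  set c := dotp (gradient _ (x + _)) d; set N := enorm d ^+ 2 in ld *.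
  have -> : l * (gam * enorm d) * enorm d = gam * (l * N) by rewrite /N; ring.
  have -> : dotp (gradient Phi x) d = - a by rewrite /a opprK.
  have Ma : M * (l * N) < a by rewrite -ltr_pdivlMr.
  move=> ca; rewrite -addrA gtrDl.
  have -> : (M - gam) * c + 3 / 4 * l * ((M - gam) ^+ 2 * N) =
    (M - gam) * (c + 3 / 4 * (M - gam) * (l * N)) by ring.
  rewrite pmulr_rlt0 ?subr_gt0 //.
  have : 0 < (M - gam) * (l * N) by rewrite mulr_gt0 ?subr_gt0.
  nra.
Qed.

End StepSize.

(** * Convex representations under an update *)

Section RepresentationUpdate.
Context {R : realType} {m p : nat} (C : 'M[R]_(m, p)) (b : 'cV[R]_m).
Implicit Types (x v q u : 'cV[R]_p) (mu : 'cV[R]_p -> R).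

Lemma sum_vertex_delta (W : nmodType) u (h : 'cV[R]_p -> W) :
  u \in vertices C b ->
  \sum_(v <- vertices C b) (if v == u then h v else 0) = h u.
Proof.
move=> uV; rewrite (big_fsetD1 u) //= eqxx big_seq big1 ?addr0 // => v.
by rewrite !inE => /andP[/negPf ->].
Qed.

Lemma convex_rep_shift x mu q u gam :
  q \in vertices C b -> u \in vertices C b -> 0 <= gam <= mu u ->
  convex_rep C b x mu ->
  convex_rep C b (x + gam *: (q - u))
    (fun v => mu v - gam * (v == u)%:R + gam * (v == q)%:R).
Proof.
move=> qV uV /andP[g0 gu] [mu0 mu1 mux]; split=> [v vV||].
- apply: addr_ge0; last by rewrite mulr_ge0.
  by case: eqP => [->|_]; rewrite ?mulr1 ?mulr0 ?subr0 ?subr_ge0 ?mu0.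
- rewrite big_split sumrB /= mu1 -!mulr_sumr.
  have one w : w \in vertices C b ->
      \sum_(v <- vertices C b) (v == w)%:R = 1 :> R.
    move=> wV; rewrite -[RHS](sum_vertex_delta (fun=> 1 : R) wV).
    by apply: eq_bigr => v _; case: eqP.
  by rewrite !one // subrK.
- have delta w : w \in vertices C b ->
      \sum_(v <- vertices C b) (gam * (v == w)%:R) *: v = gam *: w.
    move=> wV; rewrite -[RHS](sum_vertex_delta (fun v => gam *: v) wV).
    by apply: eq_bigr => v _; case: eqP; rewrite ?mulr1 ?mulr0 ?scale0r.
  under eq_bigr do rewrite scalerDl scalerBl.
  rewrite big_split sumrB /= mux !delta //.
  by rewrite scalerBr -addrA [- _ + _]addrC.
Qed.

Lemma representation_update_rep carath x mu mu' q u gam :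
  q \in vertices C b -> u \in vertices C b -> 0 <= gam <= mu u ->
  convex_rep C b x mu ->
  representation_update C b carath q u gam (x + gam *: (q - u)) mu mu' ->
  convex_rep C b (x + gam *: (q - u)) mu'.
Proof.
rewrite /representation_update; case: carath => qV uV gu rx; first by case.
move=> mu'E; have [mu0 mu1 mux] := convex_rep_shift qV uV gu rx; split.
- by move=> v vV; rewrite mu'E // mu0.
- by rewrite -mu1; apply: eq_big_seq => v vV; rewrite mu'E.
- by rewrite -[RHS]mux; apply: eq_big_seq => v vV; rewrite mu'E.
Qed.

(** A full step empties [u] and can activate only [q]; a Caratheodory reduction merely discards
    active vertices, which preserves the inclusion. *)
Lemma representation_update_active carath x' mu mu' q u : u != q ->
  representation_update C b carath q u (mu u) x' mu mu' ->
  {subset active C b mu' <= q |` (active C b mu `\ u)}%fset.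
Proof.
move=> uq; set mu1 := fun v => mu v - mu u * (v == u)%:R + mu u * (v == q)%:R.
move=> upd.
have sub1 : {subset active C b mu' <= active C b mu1}.
  move: upd; rewrite /representation_update; case: carath.
    by case=> _ _ _ /fsubsetP.
  move=> mu'E v; rewrite !inE /= => /andP[vV].
  by rewrite mu'E // vV.
move=> v /sub1; rewrite !inE /= /mu1 => /andP[-> /=].
have [->//|vq] := eqVneq v q.
have [->|vu] := eqVneq v u; first by rewrite mulr0 addr0 mulr1 subrr ltxx.
by rewrite !mulr0 subr0 addr0.
Qed.

End RepresentationUpdate.

(** * The dichotomy between noise and progress *)

Section Iteration.
Context {R : realType} {n m p : nat}.
Variables (C : 'M[R]_(m, p)) (b : 'cV[R]_m).
Variables (f : 'I_n -> 'cV[R]_p -> R) (sigma L : 'I_n -> R) (carath : bool).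
Hypothesis n0 : (0 < n)%N.
Hypothesis sc : forall i, strongly_convex (sigma i) (f i).
Hypothesis lg : forall i, lipschitz_gradient (L i) (f i).
Local Notation P := (polyhedron C b).

Definition freq (M : nat) (s : nat -> 'I_n) (i : 'I_n) : R :=
  M%:R^-1 * \sum_(j < M) (s j == i)%:R.

Definition noise (M : nat) (s : nat -> 'I_n) : R :=
  \sum_i `|freq M s i - n%:R^-1|.

Lemma noise_ge0 M s : 0 <= noise M s.
Proof. exact: sumr_ge0. Qed.

Lemma freq_ge0 M s i : 0 <= freq M s i.
Proof. by rewrite mulr_ge0 ?invr_ge0 // sumr_ge0. Qed.

Lemma sum_freq M (s : nat -> 'I_n) (h : 'I_n -> R) :
  \sum_i freq M s i * h i = M%:R^-1 * \sum_(j < M) h (s j).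
Proof.
under eq_bigr do rewrite -mulrA mulr_suml.
rewrite -mulr_sumr exchange_big /=; congr (_ * _); apply: eq_bigr => j _.
rewrite (bigD1 (s j)) //= eqxx mul1r big1 ?addr0 // => i.
by rewrite eq_sym => /negPf ->; rewrite mul0r.
Qed.

Lemma sum_freq1 M s : (0 < M)%N -> \sum_i freq M s i = 1.
Proof.
move=> M0; under eq_bigr do rewrite -[freq _ _ _]mulr1.
rewrite (sum_freq _ _ (fun=> 1)) sumr_const card_ord mulVf //.
by rewrite pnatr_eq0 -lt0n.
Qed.

Lemma sum_uniform : \sum_(i < n) n%:R^-1 = 1 :> R.
Proof.
rewrite sumr_const card_ord -[_ *+ n]mulr_natr mulVf //.
by rewrite pnatr_eq0 -lt0n.
Qed.

Lemma noise_le2 M s : (0 < M)%N -> noise M s <= 2.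
Proof.
move=> M0; apply: (@le_trans _ _ (\sum_i (freq M s i + n%:R^-1))).
  apply: ler_sum => i _; apply: le_trans (ler_normB _ _) _.
  by rewrite !ger0_norm ?freq_ge0 ?invr_ge0.
by rewrite big_split /= sum_freq1 // sum_uniform.
Qed.

Lemma F_wavg : F f = wavg f (fun=> n%:R^-1).
Proof. by apply/funext => y; rewrite /F mulr_sumr. Qed.

Lemma average_wavg M (s : nat -> 'I_n) :
  (fun y => M%:R^-1 * \sum_(j < M) f (s j) y) = wavg f (freq M s).
Proof. by apply/funext => y; rewrite -(sum_freq M s (fun i => f i y)). Qed.

(** The outcome of an iteration not dominated by noise, expressed through [F] alone so that the
    window argument involves no sample. In its use [a] is the pairwise gap of the sampled gradient;
    the last clause separates a contraction from a step that exhausts the weight of [u]. *)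
Definition progress (c1 c2 c3 D : R) x mu x' mu' : Prop :=
  exists (q u : 'cV[R]_p) (a gam : R),
  [/\ 0 < a /\ 0 <= gam,
      q \in vertices C b /\ a / 2 <= dotp (gradient (F f) x) (u - q),
      forall y, P y -> F f x - F f y <= c2 * a ^+ 2,
      F f x' <= F f x - c3 * (gam * a) /\ enorm (x' - x) <= D * gam
    & (forall y, P y -> F f x' <= F f x - c1 * (F f x - F f y)) \/
      u \in active C b mu /\
      {subset active C b mu' <= q |` (active C b mu `\ u)}%fset].

Variables (s Lm B D K : R).
Hypotheses (s0 : 0 < s) (B0 : 0 < B) (D0 : 0 < D) (K0 : 0 < K).
Hypothesis sleS : forall i, s <= sigma i.
Hypothesis L0 : forall i, 0 < L i <= Lm.
Hypothesis gradB : forall i y, P y -> enorm (gradient (f i) y) <= B.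
Hypothesis diamD : forall y z, P y -> P z -> enorm (y - z) <= D.
Hypothesis gapK : forall x mu g q u y, convex_rep C b x mu -> P y ->
  (forall y, P y -> dotp g q <= dotp g y) ->
  (forall v, v \in active C b mu -> dotp g v <= dotp g u) ->
  dotp g (x - y) <= K * dotp g (u - q) * enorm (x - y).

Let Lm0 : 0 < Lm.
Proof. by case: (L0 (Ordinal n0)) => /andP[/lt_le_trans]; apply. Qed.

(** With [r] the distance from [x] to [y], strong convexity bounds the difference by
    [c * r - s / 2 * r ^+ 2], where [c] adds up the sampled gap and the gradient error; the maximum
    over [r] is [c ^+ 2 / (2 * s)]. *)
Lemma suboptimality_gap w x mu q u y : convex_rep C b x mu -> P y ->
  let g := gradient (wavg f w) x in
  (forall y, P y -> dotp g q <= dotp g y) ->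
  (forall v, v \in active C b mu -> dotp g v <= dotp g u) ->
  F f x - F f y <=
    (K * dotp g (u - q) + (\sum_i `|w i - n%:R^-1|) * B) ^+ 2 / (2 * s).
Proof.
move=> rx Py g qmin umax; set e := \sum_i _; set a := dotp g (u - q).
have Px := convex_rep_mem rx.
have gap := gapK rx Py qmin umax; rewrite -/a in gap.
have u0 : 0 <= n%:R^-1 :> R by rewrite invr_ge0.
have := wavg_convex sc lg x y (fun=> u0) sum_uniform sleS.
have := wavg_dist lg gradB (fun=> n%:R^-1) w (x - y) Px.
rewrite -F_wavg (eq_bigr (fun i => `|w i - n%:R^-1|)); last first.
  by move=> i _; rewrite distrC.
rewrite -/e -/g -(opprB x y) dotpNr enormN.
set r := enorm (x - y) in gap *; set c := K * a + e * B.
move=> dG cv; have : F f x - F f y <= c * r - s / 2 * r ^+ 2.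
  by rewrite /c mulrDl; lra.
move=> /le_trans; apply; rewrite ler_pdivlMr ?mulr_gt0 //.
have := sqr_ge0 (c - s * r); nra.
Qed.

Let rho := 1 + 2 * Lm / s.
Let rho1 : 1 <= rho. Proof. by rewrite lerDl divr_ge0 ?mulr_ge0 // ltW. Qed.
(* A pairwise gap below M0 times the noise forces a small suboptimality;
   above it, the noise costs at most half of the sampled decrease. *)
Let M0 := 8 * rho * B * D.
Let M00 : 0 < M0. Proof. by rewrite !mulr_gt0 // (lt_le_trans _ rho1). Qed.
Let A := (K * M0 + B) ^+ 2 / s + B * D.
Let c2 := (K + B / M0) ^+ 2 / (2 * s).
Let c1 := (8 * Lm * D ^+ 2 * c2)^-1.
Let c3 := (8 * rho)^-1.

Lemma psfw_step_progress M smp x mu x' mu' : (0 < M)%N ->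
  convex_rep C b x mu -> psfw_step C b f L carath M smp x mu x' mu' ->
  [/\ convex_rep C b x' mu', F f x' <= F f x + A * noise M smp &
      (forall y, P y -> F f x - F f y <= A * noise M smp) \/
      progress c1 c2 c3 D x mu x' mu'].
Proof.
move=> Mgt0 rx; rewrite /psfw_step average_wavg -(sum_freq M smp L).
set w := freq M smp; set g := gradient _ x; set Lk := \sum_i _.
move=> [q [u [gam [[qV qmin] [ua umax] step x'E upd]]]].
have /andP[uV mu0] : (u \in vertices C b) && (0 < mu u).
  by move: ua; rewrite !inE.
have Px := convex_rep_mem rx.
have w0 i : 0 <= w i := freq_ge0 M smp i.
have w1 : \sum_i w i = 1 := sum_freq1 smp Mgt0.
have Lk0 : 0 < Lk.
  rewrite lt_def sumr_ge0 ?andbT; last first.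
    by move=> i _; rewrite mulr_ge0 // ltW //; case/andP: (L0 i).
  apply/eqP => Lk_eq0; have : \sum_i w i = 0.
    rewrite big1 // => i _; have [L0i _] := andP (L0 i).
    have wL0 j : true -> 0 <= w j * L j.
      by rewrite mulr_ge0 // ltW //; case/andP: (L0 j).
    have /eqP := psumr_eq0P wL0 Lk_eq0 (i := i) isT.
    by rewrite mulf_eq0 (gt_eqF L0i) orbF => /eqP.
  by rewrite w1 => /eqP; rewrite oner_eq0.
have Lkm : Lk <= Lm.
  rewrite -[Lm]mul1r -w1 mulr_suml; apply: ler_sum => i _.
  by rewrite ler_wpM2l //; case/andP: (L0 i).
pose a := dotp g (u - q).
have aE : - dotp g (q - u) = a by rewrite /a -dotpNr opprB.
have a0 : 0 <= a := pairwise_gap_ge0 rx qmin umax.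
have conv y z := wavg_convex sc lg y z w0 w1 sleS.
have desc y z := wavg_descent sc lg y z w0.
have lip y z t := wavg_lipschitz_gradient lg y z t w0.
have a0' : 0 <= - dotp g (q - u) by rewrite aE.
have [gam0 gamM Fdec] := stepsize_range Lk0 desc step a0' (ltW mu0).
have rx' : convex_rep C b x' mu'.
  rewrite x'E in upd *; apply: representation_update_rep rx upd => //.
  by rewrite gam0.
have Px' := convex_rep_mem rx'.
set e := noise M smp; have e0 : 0 <= e := noise_ge0 M smp.
have e2 : e <= 2 := noise_le2 smp Mgt0.
have dD : enorm (q - u) <= D by apply: diamD; exact: vertices_sub.
have xx' : enorm (x' - x) = gam * enorm (q - u).
  by rewrite x'E addrAC subrr add0r enormZ ger0_norm.
have noiseE : \sum_i `|n%:R^-1 - w i| = e.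
  by apply: eq_bigr => i _; rewrite distrC.
(* The decreases of [F] and of the batch average differ by at most [e * B] times the distance moved,
   which is at most [gam * D]. *)
have Ftrue : F f x' - F f x <= wavg f w x' - wavg f w x + gam * (e * B * D).
  rewrite F_wavg.
  have := wavg_diff sc lg gradB (fun=> n%:R^-1) w Px' Px.
  rewrite noiseE => /le_trans; apply; rewrite lerD2l xx'.
  rewrite mulrCA ler_wpM2l // ler_wpM2l //.
  by rewrite mulr_ge0 // ltW.
rewrite -x'E in Fdec.
have gam1 : gam <= 1.
  apply: le_trans gamM _; have [mu0' <- _] := rx.
  rewrite (big_fsetD1 u) //= lerDl big_seq sumr_ge0 // => v.
  by rewrite !inE => /andP[_]; exact: mu0'.
have A0 : 0 <= (K * M0 + B) ^+ 2 / s by rewrite divr_ge0 ?sqr_ge0 // ltW.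
split=> //.
  have : gam * (e * B * D) <= e * B * D.
    by rewrite ler_piMl // !mulr_ge0 // ltW.
  have : 0 <= (K * M0 + B) ^+ 2 / s * e by rewrite mulr_ge0.
  by rewrite /A mulrDl; lra.
have gap y (Py : P y) := suboptimality_gap rx Py qmin umax.
rewrite -/a -/e in gap.
have gap_ge0 : 0 <= K * a + e * B.
  by rewrite addr_ge0 // mulr_ge0 // ltW.
(* Below the threshold the gap bound is quadratic in [e], and [e <= 2] turns it into a linear
   one. *)
have [aM|aM] := leP a (M0 * e).
  left => y Py; apply: le_trans (gap y Py) _.
  apply: (@le_trans _ _ (((K * M0 + B) * e) ^+ 2 / (2 * s))).
    rewrite ler_wpM2r ?invr_ge0 ?mulr_ge0 ?(ltW s0) //.
    have le1 : K * a + e * B <= (K * M0 + B) * e.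
      by rewrite mulrDl [B * e]mulrC lerD2r -mulrA ler_wpM2l // ltW.
    by rewrite ler_pXn2r // nnegrE // (le_trans gap_ge0).
  apply: (@le_trans _ _ ((K * M0 + B) ^+ 2 / s * e)); last first.
    by rewrite ler_wpM2r // lerDl mulr_ge0 // ltW.
  have -> : ((K * M0 + B) * e) ^+ 2 / (2 * s) =
     (K * M0 + B) ^+ 2 / s * (e * (e / 2)) by field; rewrite gt_eqF.
  by rewrite ler_wpM2l // ler_piMr //; lra.
right; have a_gt0 : 0 < a by apply: le_lt_trans aM; rewrite mulr_ge0 // ltW.
rewrite -aE in a_gt0.
have := stepsize_progress s0 Lk0 conv desc lip step a_gt0 mu0; cbv zeta.
rewrite aE in a_gt0 *; set eta := a / _; set gam1' := Num.min eta _.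
rewrite -x'E => -[gam_le Fk_dec gam_full].
have eBD : 8 * rho * (e * B * D) <= a by rewrite /M0 in aM; lra.
have eBD0 : 0 <= e * B * D by rewrite !mulr_ge0 // ltW.
have q_u : 0 < enorm (q - u).
  rewrite enorm_gt0; apply: contraTneq a_gt0 => /eqP.
  by rewrite /a -enorm_eq0 enormB enorm_eq0 => /eqP ->; rewrite dotpC dotp0l ltxx.
have eta0 : 0 < eta by rewrite divr_gt0 // mulr_gt0 // exprn_gt0.
have gam1'0 : 0 < gam1' by rewrite lt_min eta0.
have gam_rho : gam <= rho * gam1'.
  apply: le_trans gam_le _; rewrite ler_wpM2r ?(ltW gam1'0) //.
  by rewrite lerD2l ler_wpM2r ?invr_ge0 ?(ltW s0) // ler_wpM2l.
(* The sampled decrease is at least [gam1' * a / 4]; by [gam <= rho * gam1'] and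
   [8 * rho * (e * B * D) <= a], noise takes away at most half of it. *)
have Fdec1 : F f x' <= F f x - gam1' * a / 8.
  have : gam * (e * B * D) <= gam1' * (a / 8).
    apply: (@le_trans _ _ (rho * gam1' * (e * B * D))).
      by rewrite ler_wpM2r.
    have -> : rho * gam1' * (e * B * D) = gam1' * (rho * (e * B * D)) by ring.
    by rewrite ler_wpM2l ?(ltW gam1'0) //; lra.
  lra.
have c2_gt0 : 0 < c2.
  apply: divr_gt0; last exact: mulr_gt0.
  by rewrite exprn_gt0 // addr_gt0 // divr_gt0.
have gap2 y : P y -> F f x - F f y <= c2 * a ^+ 2.
  move=> Py; apply: le_trans (gap y Py) _.
  have -> : c2 * a ^+ 2 = ((K + B / M0) * a) ^+ 2 / (2 * s).
    by rewrite exprMn /c2 [LHS]mulrAC.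
  rewrite ler_wpM2r ?invr_ge0 ?mulr_ge0 ?(ltW s0) //.
  have eM : e <= a / M0 by rewrite ler_pdivlMr // mulrC ltW.
  have BM : 0 <= B / M0 by rewrite divr_ge0 // ltW.
  have le1 : K * a + e * B <= (K + B / M0) * a.
    by rewrite mulrDl lerD2l mulrC -mulrA ler_wpM2l ?(ltW B0) // mulrC.
  by rewrite ler_pXn2r // nnegrE // (le_trans gap_ge0).
exists q, u, a, gam; split=> //.
- split=> //.
  have := wavg_dist lg gradB w (fun=> n%:R^-1) (u - q) Px.
  rewrite -F_wavg -/g -/a -/(noise M smp) -/e => dist.
  have : e * B * enorm (u - q) <= e * B * D.
    by rewrite enormB ler_wpM2l // mulr_ge0 // ltW.
  have : 8 * (e * B * D) <= 8 * rho * (e * B * D).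
    by rewrite ler_wpM2r // ler_peMr.
  lra.
- split; last by rewrite xx' mulrC ler_wpM2r.
  apply: le_trans Fdec1 _; rewrite lerD2l lerN2 /c3.
  rewrite mulrC ler_pdivrMr ?mulr_gt0 ?(lt_le_trans _ rho1) //.
  have := ler_wpM2r (ltW a_gt0) gam_rho; lra.
(* Without clipping, [gam1' = eta] is at least [a / (Lm * D ^+ 2)], so the decrease is at least
   [c1 * (c2 * a ^+ 2)]. With clipping, the step takes all the weight of [u]. *)
have [etaM|Meta] := leP eta (mu u).
  left => y Py; apply: le_trans Fdec1 _; rewrite lerD2l lerN2.
  rewrite /gam1' min_l //; apply: (@le_trans _ _ (c1 * (c2 * a ^+ 2))).
    have c1_gt0 : 0 < c1.
      rewrite /c1 invr_gt0; apply: mulr_gt0 c2_gt0.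
      by apply: mulr_gt0; [exact: mulr_gt0 | exact: exprn_gt0].
    by apply: ler_wpM2l; [exact: ltW | exact: gap2].
  have -> : c1 * (c2 * a ^+ 2) = a / (Lm * D ^+ 2) * a / 8.
    by rewrite /c1; field; rewrite !gt_eqF.
  rewrite ler_wpM2r // ler_wpM2r ?(ltW a_gt0) // /eta.
  rewrite ler_wpM2l ?(ltW a_gt0) // lef_pV2 ?posrE ?mulr_gt0 ?exprn_gt0 //.
  apply: ler_pM => //; [exact: ltW | exact: sqr_ge0 |].
  by rewrite ler_pXn2r // nnegrE ltW.
right; split=> //; rewrite (gam_full Meta) in upd.
apply: representation_update_active upd.
by rewrite eq_sym -subr_eq0 -enorm_gt0.
Qed.

Lemma psfw_progress_constants : exists A c1 c2 c3 : R,
  [/\ 0 < A, 0 < c1, 0 < c2 & 0 < c3] /\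
  forall M smp x mu x' mu', (0 < M)%N ->
    convex_rep C b x mu -> psfw_step C b f L carath M smp x mu x' mu' ->
    [/\ convex_rep C b x' mu', F f x' <= F f x + A * noise M smp &
        (forall y, P y -> F f x - F f y <= A * noise M smp) \/
        progress c1 c2 c3 D x mu x' mu'].
Proof.
have rho0 : 0 < rho := lt_le_trans ltr01 rho1.
have c2_gt0 : 0 < c2.
  apply: divr_gt0; last exact: mulr_gt0.
  by rewrite exprn_gt0 // addr_gt0 // divr_gt0.
exists A, c1, c2, c3; split; last exact: psfw_step_progress.
split=> //; last by rewrite /c3 invr_gt0 mulr_gt0.
  apply: ltr_wpDl; last exact: mulr_gt0.
  by rewrite divr_ge0 ?sqr_ge0 // ltW.
rewrite /c1 invr_gt0; apply: mulr_gt0 c2_gt0.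
by apply: mulr_gt0; [exact: mulr_gt0 | exact: exprn_gt0].
Qed.

End Iteration.

(** * Windows of iterations *)

Section Window.
Context {R : realType} {n m p : nat}.
Variables (C : 'M[R]_(m, p)) (b : 'cV[R]_m).
Variables (f : 'I_n -> 'cV[R]_p -> R) (L : 'I_n -> R).
Hypothesis n0 : (0 < n)%N.
Hypothesis lg : forall i, lipschitz_gradient (L i) (f i).
Local Notation P := (polyhedron C b).
Local Notation V := (vertices C b).

Variables (Fs Lm A c1 c2 c3 D : R).
Hypotheses (Lm0 : 0 < Lm) (A0 : 0 < A) (c10 : 0 < c1) (c20 : 0 < c2).
Hypotheses (c30 : 0 < c3) (D0 : 0 < D).
Hypothesis LLm : forall i, L i <= Lm.
Hypothesis diamD : forall y z, P y -> P z -> enorm (y - z) <= D.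
Hypothesis Fs_le : forall y, P y -> Fs <= F f y.
Hypothesis Fs_approx : forall x c, (forall y, P y -> F f x - F f y <= c) ->
  F f x - Fs <= c.

Section Rank.
Variable g : 'cV[R]_p.

Definition vrank (v : 'cV[R]_p) : nat :=
  (\sum_(w <- V) (dotp g w <= dotp g v)%R)%N.

Definition rank_sum (mu : 'cV[R]_p -> R) : nat :=
  (\sum_(v <- V) (v \in active C b mu) * vrank v)%N.

Lemma rank_sum_le mu : (rank_sum mu <= #|` V| * #|` V|)%N.
Proof.
have card1 (h : 'cV[R]_p -> bool) : (\sum_(v <- V) h v <= #|` V|)%N.
  rewrite cardfE -sum1_card big_seq_fsetE /=.
  by apply: leq_sum => v _; case: (h _).
apply: leq_trans (_ : \sum_(v <- V) (v \in active C b mu) * #|` V| <= _)%N.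
  by apply: leq_sum => v _; rewrite leq_mul2l card1 orbT.
by rewrite -big_distrl /= leq_mul2r card1 orbT.
Qed.

Lemma vrank_lt q u : u \in V -> dotp g q < dotp g u ->
  (vrank q < vrank u)%N.
Proof.
move=> uV qu; rewrite /vrank (big_fsetD1 u) //= [ltnRHS](big_fsetD1 u) //=.
rewrite lexx leNgt qu add0n add1n ltnS; apply: leq_sum => w _.
by have [wq|//] := leP (dotp g w) (dotp g q); rewrite (le_trans wq) // ltW.
Qed.

(** The new sum is at most that of the old active set with [u] exchanged for [q], which has smaller
    rank; it is lower still if vertices were discarded or [q] was already active. *)
Lemma rank_sum_lt mu mu' q u : q \in V -> u \in active C b mu ->
  dotp g q < dotp g u ->
  {subset active C b mu' <= q |` (active C b mu `\ u)}%fset ->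
  (rank_sum mu' < rank_sum mu)%N.
Proof.
move=> qV ua qu sub.
have uV : u \in V by move: ua; rewrite !inE => /andP[].
pose S := (\sum_(v <- V) ((v \in active C b mu) && (v != u)) * vrank v)%N.
have -> : rank_sum mu = (vrank u + S)%N.
  rewrite -(sum_vertex_delta vrank uV) -big_split /=.
  by apply: eq_bigr => v _; case: eqP => [->|_]; rewrite ?ua ?andbF ?andbT.
apply: leq_ltn_trans (_ : vrank q + S < _)%N; last first.
  by rewrite ltn_add2r vrank_lt.
rewrite -(sum_vertex_delta vrank qV) -big_split /=.
apply: leq_sum => v _; case va: (v \in active C b mu') => //.
have := sub v va; rewrite in_fset1U in_fsetD1.
by case: eqP => [->|_] /=; [rewrite mul1n leq_addr | case/andP => -> ->].
Qed.

End Rank.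

Variables (x : nat -> 'cV[R]_p) (mu : nat -> 'cV[R]_p -> R) (e : nat -> R).
Hypothesis e0 : forall k, 0 <= e k.
Hypothesis rep : forall k, convex_rep C b (x k) (mu k).
Hypothesis incr : forall k, F f (x k.+1) <= F f (x k) + A * e k.
Hypothesis alt : forall k,
  (forall y, P y -> F f (x k) - F f y <= A * e k) \/
  progress C b f c1 c2 c3 D (x k) (mu k) (x k.+1) (mu k.+1).

Local Notation h k := (F f (x k) - Fs).
Local Notation W := ((#|` V| * #|` V|).+1).

(** The first term lets one contracting iteration suffice for a whole window. The second ensures
    [Q * (1 - window_rate) < window_rate], which keeps the iterates of a non-contracting window
    close enough together to preserve the order of the exchanged vertices. *)
Definition window_rate : R :=
  let Q := 2 * Lm * D ^+ 2 * c2 / c3 in Num.max (1 - c1) ((Q + 1) / (Q + 2)).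

Let Q := 2 * Lm * D ^+ 2 * c2 / c3.
Let Q0 : 0 < Q.
Proof. by rewrite divr_gt0 // mulr_gt0 // mulr_gt0 ?exprn_gt0 // mulr_gt0. Qed.

Lemma window_rate_bounds : 0 < window_rate < 1.
Proof.
rewrite lt_max gt_max gtrBl c10 divr_gt0 ?orbT /=; last 2 first.
- by rewrite addr_gt0.
- by rewrite addr_gt0.
by rewrite ltr_pdivrMr ?mul1r ?ltrD2l ?ltr1n // addr_gt0.
Qed.

Let window_rate_c1 : 1 - c1 <= window_rate.
Proof. by rewrite le_max lexx. Qed.

Let window_rate_Q : Q * (1 - window_rate) < window_rate.
Proof.
have Q2 : 0 < Q + 2 by rewrite addr_gt0.
have : (Q + 1) / (Q + 2) <= window_rate by rewrite le_max lexx orbT.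
rewrite ler_pdivrMr // => th; have /andP[t0 t1] := window_rate_bounds.
nra.
Qed.

(* If no iteration of a window is dominated by noise and h does not contract,
   then each step moves a full weight and the iterates hardly move, so the
   gradient at the start of the window strictly orders all the exchanged
   vertices: the active sets then have decreasing rank sums. *)
Lemma window_contraction_noiseless k :
  (forall i, (i < W)%N -> progress C b f c1 c2 c3 D (x (k + i)) (mu (k + i))
     (x (k + i).+1) (mu (k + i).+1)) ->
  h (k + W)%N <= window_rate * h k.
Proof.
move=> prog; rewrite leNgt; apply/negP; set th := window_rate; set H := h k.
move=> nocontr; have /andP[th0 th1] := window_rate_bounds.
have dec i : (i < W)%N -> h (k + i).+1 <= h (k + i)%N.
  move=> /prog[q [u [a [gam [[a0 gam0] _ _ [Fd _] _]]]]].
  rewrite lerD2r; apply: le_trans Fd _.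
  by rewrite gerBl mulr_ge0 ?mulr_ge0 // ltW.
have decW i j : (i + j <= W)%N -> h (k + (i + j))%N <= h (k + i)%N.
  elim: j => [|j IH]; first by rewrite addn0.
  rewrite addnS => ij; rewrite addnS.
  exact: le_trans (dec _ ij) (IH (ltnW ij)).
have leH i : (i <= W)%N -> h (k + i)%N <= H.
  by move=> iW; have := decW 0%N i; rewrite add0n addn0; apply.
have geW i : (i <= W)%N -> h (k + W)%N <= h (k + i)%N.
  by move=> iW; have := decW i (W - i)%N; rewrite subnKC //; apply.
have H0 : 0 < H.
  have := lt_le_trans nocontr (leH _ (leqnn W)).
  by rewrite -subr_gt0 -{1}[H]mul1r -mulrBl pmulr_rgt0 // subr_gt0.
(* In a non-contracting window [h] stays above [th * H], so [h <= c2 * a ^+ 2] makes every gap [a]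
   at least this [alpha]. *)
pose alpha := Num.sqrt (th * H / c2).
have al2 : c2 * alpha ^+ 2 = th * H.
  by rewrite sqr_sqrtr ?divr_ge0 ?mulr_ge0 ?ltW // mulrC divfK // gt_eqF.
have al0 : 0 < alpha by rewrite sqrtr_gt0 divr_gt0 // mulr_gt0.
(* The last factor bounds the displacement from [x k]; multiplied by [Lm * D] it bounds the change
   of the gradient along [u - q], to be kept below the guaranteed gap [a / 2 >= alpha / 2]. *)
have small : Lm * D * (D / (c3 * alpha) * ((1 - th) * H)) < alpha / 2.
  have -> : Lm * D * (D / (c3 * alpha) * ((1 - th) * H)) =
      Q * (1 - th) * H / (2 * c2 * alpha).
    by rewrite /Q; field; rewrite !gt_eqF.
  rewrite ltr_pdivrMr ?mulr_gt0 //.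
  have -> : alpha / 2 * (2 * c2 * alpha) = c2 * alpha ^+ 2 by field.
  by rewrite al2 ltr_pM2r.
pose g := gradient (F f) (x k).
have claim j : (j <= W)%N ->
    enorm (x (k + j)%N - x k) <= D / (c3 * alpha) * (H - h (k + j)%N) /\
    (rank_sum g (mu (k + j)%N) + j <= rank_sum g (mu k))%N.
  elim: j => [_|j IH jW].
    by rewrite !addn0 !subrr enorm0 mulr0.
  have [dist rks] := IH (ltnW jW).
  have [q [u [a [gam [[a0 gam0] [qV ga] gap [Fd xx] good]]]]] := prog j jW.
  have hj : h (k + j)%N <= c2 * a ^+ 2 := Fs_approx gap.
  have thj i : (i <= W)%N -> th * H < h (k + i)%N.
    by move=> /geW; apply: lt_le_trans.
  have al_a : alpha <= a.
    rewrite -(ler_pXn2r (n := 2)) ?nnegrE ?(ltW a0) ?(ltW al0) //.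
    rewrite -(ler_pM2l c20) al2 (le_trans _ hj) // ltW //.
    exact: thj (ltnW jW).
  rewrite !addnS; split.
    have -> : x (k + j).+1 - x k = x (k + j).+1 - x (k + j)%N + (x (k + j)%N - x k).
      by rewrite addrA subrK.
    apply: le_trans (enormD _ _) _.
    have step : D * gam <= D / (c3 * alpha) * (h (k + j)%N - h (k + j).+1).
      rewrite -mulrA ler_wpM2l ?(ltW D0) // mulrC ler_pdivlMr ?mulr_gt0 //.
      have := ler_wpM2l gam0 al_a; rewrite -(ler_pM2l c30); lra.
    have := lerD (le_trans xx step) dist.
    by rewrite -mulrDr; move=> /le_trans; apply; rewrite le_eqVlt; apply/orP; left;
       apply/eqP; congr (_ * _); ring.
  apply: leq_trans rks; rewrite -addSn leq_add2r.
  (* A contracting iteration would bring [h] down to at most [th * H], which is excluded; hence the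
     vertices are exchanged. *)
  case: good => [good|[ua sub]].
    have : h (k + j)%N <= (h (k + j)%N - h (k + j).+1) / c1.
      apply: Fs_approx => y Py; rewrite ler_pdivlMr // mulrC.
      by have := good y Py; lra.
    rewrite ler_pdivlMr // => hc.
    have := thj j.+1 jW; rewrite addnS => th1j.
    have := leH j (ltnW jW); have := thj j (ltnW jW) => thj0 leHj.
    have : th * h (k + j)%N <= th * H by rewrite ler_wpM2l // ltW.
    have hj0 : 0 <= h (k + j)%N.
      by rewrite (le_trans _ (ltW thj0)) // mulr_ge0 // ltW.
    have : (1 - c1) * h (k + j)%N <= th * h (k + j)%N by rewrite ler_wpM2r.
    lra.
  apply: (rank_sum_lt qV ua _ sub).
  have uV : u \in V by move: ua; rewrite !inE => /andP[].
  have uq : enorm (u - q) <= D by apply: diamD; exact: vertices_sub.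
  have w0 : 0 <= n%:R^-1 :> R by rewrite invr_ge0.
  have := wavg_lipschitz_gradient lg (x (k + j)%N) (x k) (u - q) (fun=> w0).
  rewrite -F_wavg -/g -subr_gt0 -dotpBr.
  have : (\sum_i n%:R^-1 * L i) * enorm (x (k + j)%N - x k) * enorm (u - q)
      <= Lm * (D / (c3 * alpha) * (H - h (k + j)%N)) * D.
    have Lavg : \sum_i n%:R^-1 * L i <= Lm.
      have -> : Lm = \sum_(i < n) n%:R^-1 * Lm.
        by rewrite -mulr_suml sum_uniform // mul1r.
      by apply: ler_sum => i _; apply: ler_wpM2l.
    apply: (@le_trans _ _ (Lm * enorm (x (k + j)%N - x k) * D)); last first.
      exact: (ler_wpM2r (ltW D0) (ler_wpM2l (ltW Lm0) dist)).
    apply: le_trans (ler_wpM2r (enorm_ge0 _) (ler_wpM2r (enorm_ge0 _) Lavg)) _.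
    by rewrite ler_wpM2l ?mulr_ge0 ?enorm_ge0 // ltW.
  have : Lm * (D / (c3 * alpha) * (H - h (k + j)%N)) * D <= 
      Lm * D * (D / (c3 * alpha) * ((1 - th) * H)).
    rewrite mulrAC ler_wpM2l ?mulr_ge0 ?(ltW Lm0) ?(ltW D0) //.
    rewrite ler_wpM2l ?divr_ge0 ?mulr_ge0 ?(ltW D0) ?(ltW c30) ?(ltW al0) //.
    by have := thj j (ltnW jW); lra.
  lra.
(* At [j = W] the initial rank sum would be at least [W], one more than its largest possible
   value. *)
have [_] := claim W (leqnn W).
move=> /(leq_trans (leq_addl _ _)) /leq_trans /(_ (rank_sum_le _ _)).
by rewrite ltnn.
Qed.

(** If some iteration of the window is dominated by noise, [h] is at most [A * e] there and grows by
    at most [A * e] at each later iteration, whence the factor 2. Otherwise the noiseless case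
    applies. *)
Lemma window_contraction k :
  h (k + W)%N <= window_rate * h k + 2 * A * \sum_(i < W) e (k + i)%N.
Proof.
have /andP[th0 th1] := window_rate_bounds.
have hk0 : 0 <= h k by rewrite subr_ge0 Fs_le //; exact: convex_rep_mem (rep k).
have sum0 (r : seq 'I_W) Pr : 0 <= \sum_(i <- r | Pr i) e (k + i)%N.
  by apply: sumr_ge0.
have [[i [iW dom]]|noisy] := pselect (exists i, (i < W)%N /\
    (forall y, P y -> F f (x (k + i)%N) - F f y <= A * e (k + i)%N)).
  have grow j : (i + j <= W)%N ->
      h (k + (i + j))%N <= h (k + i)%N + A * \sum_(i <= l < i + j) e (k + l)%N.
    elim: j => [|j IH]; first by rewrite addn0 big_geq // mulr0 addr0.
    rewrite addnS => ij; rewrite big_nat_recr ?leq_addr //= addnS.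
    by have := incr (k + (i + j)); have := IH (ltnW ij); lra.
  have := grow (W - i)%N; rewrite subnKC ?(ltnW iW) // => /(_ (leqnn _)).
  have hi : h (k + i)%N <= A * e (k + i)%N := Fs_approx dom.
  have s1 : e (k + i)%N <= \sum_(l < W) e (k + l)%N.
    by rewrite (bigD1 (Ordinal iW)) //= lerDl.
  have s2 : \sum_(i <= l < W) e (k + l)%N <= \sum_(l < W) e (k + l)%N.
    rewrite -(big_mkord xpredT (fun l => e (k + l)%N)).
    by rewrite (big_cat_nat (leq0n i) (ltnW iW)) //= lerDr sumr_ge0.
  have := ler_wpM2l (ltW A0) s1; have := ler_wpM2l (ltW A0) s2.
  have : 0 <= window_rate * h k by rewrite mulr_ge0 // ltW.
  lra.
apply: ler_wpDr; first by rewrite mulr_ge0 // mulr_ge0 // ltW.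
apply: window_contraction_noiseless => i iW.
by case: (alt (k + i)) => // dom; case: noisy; exists i.
Qed.

End Window.

(** * Geometric decay from the window recursion *)

Section WindowRecursion.
Context {R : realType}.

Lemma bernoulli_expr (r : R) k : 0 <= r <= 1 -> 1 - k%:R * (1 - r) <= r ^+ k.
Proof.
move=> /andP[r0 r1]; elim: k => [|k IH]; first by rewrite mul0r subr0 expr0.
have : r * (1 - k%:R * (1 - r)) <= r * r ^+ k by rewrite ler_wpM2l.
have k0 : 0 <= k%:R :> R by [].
have : 0 <= k%:R * (1 - r) ^+ 2 by rewrite mulr_ge0 ?sqr_ge0.
rewrite [r ^+ k.+1]exprS -(natr1 k); lra.
Qed.

(** The constants [r], [c] and [d] come before the sequences, so that the result can be applied
    outcome by outcome with a random [K]. *)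
Lemma window_recursion_decay (W : nat) (th s A : R) : (0 < W)%N ->
  0 < th < 1 -> 0 < s < 1 -> 0 <= A ->
  exists r c d : R, [/\ 0 < r < 1, 0 <= c, 0 <= d &
    forall (h e : nat -> R) (H K : R), 0 <= H -> 0 <= K ->
      (forall k, h k <= H) -> (forall k, e k <= K * s ^+ k) ->
      (forall k, h (k + W)%N <= th * h k + A * \sum_(i < W) e (k + i)%N) ->
      forall k, h k <= (c * H + d * K) * r ^+ k].
Proof.
move=> W0 /andP[th0 th1] /andP[s0 s1] A0.
have W0' : 0 < W%:R :> R by rewrite ltr0n.
(* By the Bernoulli inequality, [r ^+ W >= 1 - W * (1 - r) >= (1 + th) / 2 > th]. *)
pose r := Num.max s (1 - (1 - th) / (2 * W%:R)).
have sr : s <= r by rewrite le_max lexx.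
have r0 : 0 < r by exact: lt_le_trans sr.
have r1 : r < 1.
  by rewrite gt_max s1 gtrBl divr_gt0 ?subr_gt0 // mulr_gt0.
have rW : th < r ^+ W.
  have : 1 - W%:R * (1 - r) <= r ^+ W.
    by apply: bernoulli_expr; rewrite !ltW.
  have : 1 - (1 - th) / (2 * W%:R) <= r by rewrite le_max lexx orbT.
  have -> : (1 - th) / (2 * W%:R) = (1 - th) / 2 / W%:R.
    by field; rewrite gt_eqF.
  rewrite lerBlDr -lerBlDl ler_pdivlMr // mulrC => lo; lra.
have rW0 : 0 < r ^+ W by rewrite exprn_gt0.
have dr0 : 0 < r ^+ W - th by rewrite subr_gt0.
(* The choice of [c] covers the first [W] indices, where [r ^+ k >= r ^+ W]; that of [d] gives
   [th * Z + A * W * K <= Z * r ^+ W], the induction step from [j] to [j + W]. *)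
exists r, (r ^+ W)^-1, (A * W%:R / (r ^+ W - th)).
split; [by rewrite r0 | by rewrite invr_ge0 ltW | |].
  by rewrite divr_ge0 ?mulr_ge0 // ltW.
move=> h e H K H0 K0 hH eK rec; set Z := _ + _.
have Z0 : (r ^+ W)^-1 * H <= Z.
  by rewrite lerDl !mulr_ge0 ?invr_ge0 ?(ltW dr0) ?(ltW W0').
have Z1 : A * W%:R * K <= Z * (r ^+ W - th).
  rewrite mulrDl [X in _ <= _ + X]mulrAC divfK ?gt_eqF // lerDr.
  by rewrite mulr_ge0 ?(ltW dr0) // mulr_ge0 // invr_ge0 ltW.
elim/ltn_ind => k IH; have [kW|Wk] := ltnP k W.
  apply: le_trans (hH k) _; apply: (@le_trans _ _ ((r ^+ W)^-1 * H * r ^+ k)).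
    rewrite mulrC mulrA mulrC ler_peMr // ler_pdivlMr // mul1r.
    by rewrite ler_wiXn2l ?ltW // ltnW.
  by rewrite ler_wpM2r // exprn_ge0 // ltW.
rewrite -(subnK Wk); set j := (k - W)%N.
apply: le_trans (rec j) _.
have jk : (j < k)%N by rewrite ltn_subrL W0 (leq_trans W0).
have hj : th * h j <= th * (Z * r ^+ j) by rewrite ler_wpM2l ?(ltW th0) // IH.
have rj0 : 0 < r ^+ j by rewrite exprn_gt0.
have es : A * \sum_(i < W) e (j + i)%N <= A * W%:R * K * r ^+ j.
  rewrite -!mulrA ler_wpM2l //.
  apply: (@le_trans _ _ (\sum_(i < W) K * r ^+ j)); last first.
    by rewrite sumr_const card_ord mulr_natl.
  apply: ler_sum => i _; apply: le_trans (eK _) _; rewrite ler_wpM2l //.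
  rewrite exprD; apply: (@le_trans _ _ (s ^+ j)).
    by rewrite ler_piMr ?exprn_ge0 ?exprn_ile1 // ltW.
  by rewrite lerXn2r // nnegrE ltW.
have : A * W%:R * K * r ^+ j <= Z * (r ^+ W - th) * r ^+ j.
  by rewrite ler_wpM2r // ltW.
rewrite exprD; lra.
Qed.

End WindowRecursion.

(** * Sampling noise *)

Section Deviations.
Context {R : realType} {disp : measure_display} {T : measurableType disp}.
Variable P : probability T R.
Local Open Scope ereal_scope.

(** The integral is a supremum over the simple functions below the integrand, so enlarging the
    integrand enlarges the set of candidates. The later use is for [h k], known only through
    bounds. *)
Lemma ge0_integral_mono (f g : T -> \bar R) :
  (forall w, 0 <= f w) -> (forall w, f w <= g w) ->
  \int[P]_w f w <= \int[P]_w g w.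
Proof.
move=> f0 fg; have g0 w : 0 <= g w by exact: le_trans (fg w).
rewrite !ge0_integralTE //; apply: le_ereal_sup => _ [h hf <-].
by exists h => // w; exact: le_trans (fg w).
Qed.

Section Frequencies.
Variables (M : nat) (A : 'I_M -> set T) (c t : R).
Hypotheses (M0 : (0 < M)%N) (mA : forall j, measurable (A j)).
Hypothesis PA : forall j, P (A j) = c%:E.
Hypothesis PAA : forall j l, j != l -> P (A j `&` A l) = (c ^+ 2)%:E.
Hypotheses (t0 : (0 < t)%R) (Mt : (M%:R^-1 <= t ^+ 2)%R).

Let N (w : T) : R := (\sum_j \1_(A j) w)%R.

Let mN : measurable_fun [set: T] N.
Proof. by apply: measurable_sum => j; exact: measurable_indic. Qed.

Let N0 w : (0 <= N w)%R.
Proof. by apply: sumr_ge0 => j _; rewrite indicE. Qed.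

Lemma integral_count : \int[P]_w (N w)%:E = (M%:R * c)%:E.
Proof.
under eq_integral do rewrite -sumEFin.
rewrite ge0_integral_sum //; last first.
  by move=> j; apply/measurable_EFinP; exact: measurable_indic.
rewrite (eq_bigr (fun=> c%:E)); last first.
  by move=> j _; rewrite integral_indic // setIT; exact: PA.
by rewrite sumEFin sumr_const card_ord mulr_natl.
Qed.

(** The [M] diagonal pairs contribute [c] each, and the [M * (M - 1)] others [c ^+ 2] by pairwise
    independence. *)
Lemma integral_count2 :
  \int[P]_w (N w ^+ 2)%:E = (M%:R * c + M%:R * (M%:R - 1) * c ^+ 2)%:E.
Proof.
have NE w : (N w ^+ 2)%:E = \sum_j \sum_l (\1_(A j `&` A l) w)%:E.
  rewrite expr2 /N big_distrl -sumEFin; apply: eq_bigr => j _ /=.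
  rewrite big_distrr -sumEFin; apply: eq_bigr => l _ /=.
  by rewrite indicI.
under eq_integral do rewrite NE.
have mAA j l : measurable (A j `&` A l) by exact: measurableI.
have mI j l : measurable_fun [set: T] (fun w => (\1_(A j `&` A l) w : R)%:E).
  by apply/measurable_EFinP; exact: measurable_indic.
have I0 j l w : 0 <= (\1_(A j `&` A l) w : R)%:E by rewrite lee_fin indicE.
rewrite ge0_integral_sum //; last 2 first.
- by move=> j; apply: emeasurable_sum.
- by move=> j w _; apply: sume_ge0.
rewrite (eq_bigr (fun=> (c + (M%:R - 1) * c ^+ 2)%:E)); last first.
  move=> j _; rewrite ge0_integral_sum //.
  rewrite (bigD1 j) //= integral_indic // setIT setIid EFinD.
  congr (_ + _); first exact: PA.
  rewrite (eq_bigr (fun=> (c ^+ 2)%:E)); last first.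
    by move=> l lj; rewrite integral_indic // setIT; apply: PAA; rewrite eq_sym.
  rewrite sumEFin sumr_const cardC1 card_ord -(mulr_natl (c ^+ 2)).
  have -> // : (M%:R - 1 = M.-1%:R :> R)%R.
  by case: M M0 => // k; rewrite -natr1 addrK.
rewrite sumEFin sumr_const card_ord -(mulr_natl (_ + _)); congr EFin; ring.
Qed.

(** The deviation [z] has second moment [(c - c ^+ 2) / M <= t ^+ 2], and
    [|z| <= z ^+ 2 / (2 * t) + t / 2]. The square is expanded as [e * N ^+ 2 - d * N] plus a
    constant, and [d * N] is moved to the left so that only nonnegative functions are integrated. *)
Lemma integral_frequency_deviation :
  \int[P]_w (`|M%:R^-1 * N w - c|%R)%:E <= t%:E.
Proof.
have Mr0 : (0 < M%:R :> R)%R by rewrite ltr0n.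
have c0 : (0 <= c)%R by rewrite -lee_fin -(PA (Ordinal M0)).
pose d := (c / (M%:R * t))%R.
have d0 : (0 <= d)%R by rewrite divr_ge0 ?mulr_ge0 ?(ltW t0).
pose e := ((2 * M%:R ^+ 2 * t)^-1)%R.
have e0 : (0 <= e)%R by rewrite invr_ge0 !mulr_ge0 ?exprn_ge0 ?(ltW t0).
pose k := (c ^+ 2 / (2 * t) + t / 2)%R.
have k0 : (0 <= k)%R.
  by rewrite addr_ge0 ?divr_ge0 ?sqr_ge0 ?mulr_ge0 ?(ltW t0).
have mdev : measurable_fun [set: T] (fun w => (`|M%:R^-1 * N w - c|%R)%:E).
  apply/measurable_EFinP; apply: measurableT_comp => //.
  by apply: measurable_funB => //; exact: measurable_funM.
have mdN : measurable_fun [set: T] (fun w => (d * N w)%:E).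
  by apply/measurable_EFinP; exact: measurable_funM.
have mN2 : measurable_fun [set: T] (fun w => (N w ^+ 2)%:E).
  by apply/measurable_EFinP; exact: measurable_funX.
have meN2 : measurable_fun [set: T] (fun w => (e * N w ^+ 2)%:E).
  by apply/measurable_EFinP; apply: measurable_funM => //; exact: measurable_funX.
have lhs : \int[P]_w ((`|M%:R^-1 * N w - c|%R)%:E + (d * N w)%:E) =
    \int[P]_w (`|M%:R^-1 * N w - c|%R)%:E + (d * (M%:R * c))%:E.
  rewrite ge0_integralD //; last first.
    by move=> w _; rewrite lee_fin mulr_ge0.
  congr (_ + _); under eq_integral do rewrite EFinM.
  rewrite ge0_integralZl ?lee_fin //; first by rewrite integral_count.
    exact/measurable_EFinP.
  by move=> w _; rewrite lee_fin.
have rhs : \int[P]_w ((e * N w ^+ 2)%:E + k%:E) =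
    (e * (M%:R * c + M%:R * (M%:R - 1) * c ^+ 2) + k)%:E.
  rewrite ge0_integralD //; last first.
    by move=> w _; rewrite lee_fin mulr_ge0 ?sqr_ge0.
  rewrite [RHS]EFinD; congr (_ + _).
    under eq_integral do rewrite EFinM.
    rewrite ge0_integralZl ?lee_fin //; first by rewrite integral_count2.
    by move=> w _; rewrite lee_fin sqr_ge0.
  rewrite integral_cst // -[RHS]mule1; congr (_ * _).
  exact: probability_setT.
rewrite -(@leeD2rE _ (d * (M%:R * c))%:E) // -lhs.
apply: (@le_trans _ _ (\int[P]_w ((e * N w ^+ 2)%:E + k%:E))).
  apply: ge0_integral_mono => w.
    by rewrite adde_ge0 // lee_fin // mulr_ge0.
  rewrite -!EFinD lee_fin; set z := (M%:R^-1 * N w - c)%R.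
  have -> : (e * N w ^+ 2 + k = z ^+ 2 / (2 * t) + t / 2 + d * N w)%R.
    by rewrite /z /e /k /d; field; rewrite !gt_eqF.
  rewrite lerD2r -subr_ge0.
  have -> : (z ^+ 2 / (2 * t) + t / 2 - `|z| = (`|z| - t) ^+ 2 / (2 * t))%R.
    by rewrite -[(z ^+ 2)%R]real_normK ?num_real //; field; rewrite gt_eqF.
  by rewrite divr_ge0 ?sqr_ge0 // mulr_ge0 // ltW.
rewrite rhs -EFinD lee_fin.
have -> : (e * (M%:R * c + M%:R * (M%:R - 1) * c ^+ 2) + k =
   M%:R^-1 * (c - c ^+ 2) / (2 * t) + t / 2 + d * (M%:R * c))%R.
  by rewrite /e /k /d; field; rewrite !gt_eqF.
rewrite lerD2r.
have : (M%:R^-1 * (c - c ^+ 2) / (2 * t) <= t ^+ 2 / (2 * t))%R.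
  rewrite ler_wpM2r ?invr_ge0 ?mulr_ge0 ?(ltW t0) //.
  apply: le_trans Mt; rewrite ler_piMr ?invr_ge0 //.
  have := sqr_ge0 (c - 1 / 2)%R; nra.
have -> : (t ^+ 2 / (2 * t) = t / 2)%R by field; rewrite gt_eqF.
lra.
Qed.

End Frequencies.
End Deviations.

Lemma half_above (R : realFieldType) (q : R) : 0 < q -> q < 1 ->
  [/\ 0 < (1 + q) / 2, (1 + q) / 2 < 1 & q < (1 + q) / 2].
Proof. by move=> q0 q1; split; lra. Qed.

(** * Pathwise and expected decay under geometrically small noise *)

Section GeometricNoise.
Context {R : realType} {disp : measure_display} {T : measurableType disp}.
Variable P : probability T R.
Variables (e : nat -> T -> R) (c q : R).
Hypotheses (e0 : forall k w, 0 <= e k w)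
  (me : forall k, measurable_fun [set: T] (e k)).
Hypotheses (c0 : 0 <= c) (q0 : 0 < q) (q1 : q < 1).
Hypothesis int_e : forall k, (\int[P]_w (e k w)%:E <= (c * q ^+ k)%:E)%E.

Let s := (1 + q) / 2.

Let rate_between : [/\ 0 < s, s < 1 & q < s] := half_above q0 q1.

(** The random constant [K] with [e k <= K * s ^+ k] for all [k]; it may be infinite on a null
    set. *)
Definition scaled_sum (w : T) : \bar R :=
  (\big[+%E/0%E]_(0 <= k <oo) (e k w / s ^+ k)%:E)%E.

Let s0 : 0 < s. Proof. by case: rate_between. Qed.

Let term_ge0 k w : (0 <= (e k w / s ^+ k)%:E)%E.
Proof. by rewrite lee_fin divr_ge0 // exprn_ge0 // ltW. Qed.

Let mterm k : measurable_fun [set: T] (fun w => (e k w / s ^+ k)%:E).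
Proof. by apply/measurable_EFinP; exact: measurable_funM. Qed.

Lemma scaled_sum_ge0 w : (0 <= scaled_sum w)%E.
Proof. by apply: nneseries_ge0 => k _ _; exact: term_ge0. Qed.

Lemma measurable_scaled_sum : measurable_fun [set: T] scaled_sum.
Proof. by apply: ge0_emeasurable_sum => // k w _ _; exact: term_ge0. Qed.

Lemma scaled_sum_ge k w : ((e k w / s ^+ k)%:E <= scaled_sum w)%E.
Proof.
apply: le_trans (nneseries_lim_ge k.+1 (fun j _ _ => term_ge0 j w)).
by rewrite big_nat_recr //= leeDr // sume_ge0.
Qed.

(** Termwise integration leaves a geometric series of ratio [q / s < 1]. *)
Lemma integral_scaled_sum :
  (\int[P]_w scaled_sum w <= (c / (1 - q / s))%:E)%E.
Proof.
have [_ s1 qs] := rate_between.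
have qs1 : q / s < 1 by rewrite ltr_pdivrMr // mul1r.
have qs0 : 0 <= q / s by rewrite divr_ge0 // ltW.
rewrite integral_nneseries //; apply: lime_le.
  by apply: is_cvg_nneseries => k _ _; apply: integral_ge0 => w _.
near=> N; apply: (@le_trans _ _ (\sum_(0 <= k < N) (c * (q / s) ^+ k)%:E)%E).
  apply: lee_sum => k _.
  under eq_integral do rewrite mulrC EFinM.
  rewrite ge0_integralZl ?lee_fin ?invr_ge0 ?exprn_ge0 ?(ltW s0) //; last 2 first.
  - exact/measurable_EFinP.
  - by move=> w _; rewrite lee_fin.
  apply: (@le_trans _ _ ((s ^+ k)^-1%:E * (c * q ^+ k)%:E)%E).
    by rewrite lee_wpmul2l // lee_fin invr_ge0 exprn_ge0 // ltW.
  rewrite -EFinM.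
  by rewrite [(q / s) ^+ k]expr_div_n mulrCA [X in c * X]mulrC.
rewrite sumEFin lee_fin -mulr_sumr ler_wpM2l //.
rewrite -[leRHS]mul1r ler_pdivlMr ?subr_gt0 //.
have -> : (\sum_(0 <= k < N) (q / s) ^+ k) * (1 - q / s) = 1 - (q / s) ^+ N.
  by rewrite big_mkord -[LHS]opprK -mulrN opprB mulrC -subrX1 opprB.
by rewrite gerBl exprn_ge0.
Unshelve. all: by end_near. Qed.

Variables (h : nat -> T -> R) (H d r : R).
Hypotheses (h0 : forall k w, 0 <= h k w) (H0 : 0 <= H) (d0 : 0 <= d) (r0 : 0 < r).
Hypothesis decay : forall w K, 0 <= K -> (forall k, e k w <= K * s ^+ k) ->
  forall k, h k w <= (H + d * K) * r ^+ k.

Let decay_fin w K : scaled_sum w = K%:E ->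
  0 <= K /\ forall k, h k w <= (H + d * K) * r ^+ k.
Proof.
move=> KE; have K0 : 0 <= K by rewrite -lee_fin -KE scaled_sum_ge0.
split=> //; apply: decay => // k.
by rewrite -ler_pdivrMr ?exprn_gt0 // -lee_fin -KE scaled_sum_ge.
Qed.

Lemma expected_decay : exists2 c' : R, 0 <= c' &
  forall k, (\int[P]_w (h k w)%:E <= (c' * r ^+ k)%:E)%E.
Proof.
have [_ s1 qs] := rate_between.
have qs1 : 0 < 1 - q / s by rewrite subr_gt0 ltr_pdivrMr // mul1r.
have d1 : 0 < d + 1 by rewrite ltr_wpDl.
exists (H + (d + 1) * (c / (1 - q / s))) => [|k].
  by rewrite addr_ge0 // mulr_ge0 ?(ltW d1) // divr_ge0 // ltW.
have rk : 0 < r ^+ k by rewrite exprn_gt0.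
(* The factor [d + 1] instead of [d] is positive, so [g] is infinite wherever [scaled_sum] is; with
   [d = 0] the product would be 0 there. *)
pose g w : \bar R := ((H * r ^+ k)%:E + ((d + 1) * r ^+ k)%:E * scaled_sum w)%E.
apply: (@le_trans _ _ (\int[P]_w g w)%E).
  apply: ge0_integral_mono => w; first by rewrite lee_fin.
  rewrite /g; case KE : (scaled_sum w) => [K| |].
  - have [K0 hK] := decay_fin KE; rewrite -EFinM -EFinD lee_fin.
    apply: le_trans (hK k) _; rewrite mulrDl lerD2l mulrAC ler_wpM2r //.
    by rewrite ler_wpM2r ?(ltW rk) // lerDl.
  - by rewrite gt0_muley ?lte_fin ?mulr_gt0 // addey // leey.
  - by have := scaled_sum_ge0 w; rewrite KE.
rewrite /g ge0_integralD //; last 3 first.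
- by move=> w _; rewrite lee_fin mulr_ge0 // ltW.
- by move=> w _; rewrite mule_ge0 ?scaled_sum_ge0 // lee_fin mulr_ge0 ?ltW.
- by apply: emeasurable_funM => //; exact: measurable_scaled_sum.
rewrite ge0_integralZl ?lee_fin //; last 3 first.
- exact: measurable_scaled_sum.
- by move=> w _; exact: scaled_sum_ge0.
- by rewrite mulr_ge0 // ltW.
have -> : (\int[P]__ (H * r ^+ k)%:E = (H * r ^+ k)%:E)%E.
  rewrite integral_cst // -[RHS]mule1; congr (_ * _)%E.
  exact: probability_setT.
rewrite [(H + _) * _]mulrDl [leRHS]EFinD leeD2l //.
apply: (@le_trans _ _ (((d + 1) * r ^+ k)%:E * (c / (1 - q / s))%:E)%E).
  by rewrite lee_wpmul2l ?integral_scaled_sum // lee_fin mulr_ge0 // ltW.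
by rewrite -EFinM lee_fin mulrAC.
Qed.

(** A finite expectation makes [scaled_sum] finite almost everywhere, and its finite values are
    admissible for [K]. *)
Lemma ae_decay : {ae P, forall w, exists2 Z, 0 <= Z &
  forall k, h k w <= Z * r ^+ k}.
Proof.
have int_sum : P.-integrable [set: T] scaled_sum.
  apply/integrableP; split; first exact: measurable_scaled_sum.
  under eq_integral do rewrite gee0_abs ?scaled_sum_ge0 //.
  exact: le_lt_trans integral_scaled_sum (ltry _).
have := integrable_ae measurableT int_sum.
apply: filterS => w /(_ I); case KE : (scaled_sum w) => [K| |] // _.
have [K0 hK] := decay_fin KE; exists (H + d * K) => //.
by rewrite addr_ge0 // mulr_ge0.
Qed.

End GeometricNoise.

(** * The sampling noise of the algorithm *)

Section PsfwNoise.
Context {R : realType} {n m p : nat}.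
Variables (C : 'M[R]_(m, p)) (b : 'cV[R]_m).
Variables (f : 'I_n -> 'cV[R]_p -> R) (sigma L : 'I_n -> R) (carath : bool).
Context {disp : measure_display} {T : measurableType disp}.
Variable P : probability T R.
Variables (past : nat -> set (set T)) (xi : nat -> nat -> T -> 'I_n).
Variables (x : nat -> T -> 'cV[R]_p) (mu : nat -> T -> 'cV[R]_p -> R).
Hypothesis alg : psfw C b f sigma L carath P past xi x mu.
Local Notation kap := (kappa C b sigma L carath).
Local Notation M := (batch_size C b sigma L carath).
Hypotheses (kap0 : 0 < kap) (kap1 : kap < 1).

Let q0 : 0 < 1 - kap. Proof. by rewrite subr_gt0. Qed.

Lemma batch_size_ge k : 1 / (1 - kap) ^+ (2 * k + 2) <= (M k)%:R.
Proof.
have pos : 0 < 1 / (1 - kap) ^+ (2 * k + 2) by rewrite divr_gt0 // exprn_gt0.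
rewrite /batch_size natr_absz ger0_norm ?ceil_ge //.
by rewrite ceil_ge0 (lt_trans _ pos) // ltrN10.
Qed.

Lemma batch_size_gt0 k : (0 < M k)%N.
Proof.
rewrite -(ltr0n R); apply: lt_le_trans (batch_size_ge k).
by rewrite divr_gt0 // exprn_gt0.
Qed.

Let draw k (j : 'I_(M k)) (i : 'I_n) := [set w | xi k j w = i].

Let draw_sigma k (j : 'I_(M k)) i : sigma_of (xi k j) (draw j i).
Proof.
by exists [set i] => //; rewrite setTI.
Qed.

Let mdraw k (j : 'I_(M k)) i : (0 < k)%N -> measurable (draw j i).
Proof.
move=> k0; apply: (past_measurable alg (ltn0Sn k)).
exact: (draws_adapted alg k0 (ltn_ord j)) (draw_sigma j i).
Qed.

Let draw_pair k (j l : 'I_(M k)) i : (0 < k)%N -> j != l ->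
  P (draw j i `&` draw l i) = ((n%:R^-1) ^+ 2)%:E.
Proof.
move=> k0 jl.
pose A (o : option 'I_(M k)) := if o is Some j' then draw j' i else setT.
have := draws_independent alg k0 (J := [set Some j; Some l]%SET) (A := A).
have -> : \bigcap_(o in [set` [set Some j; Some l]%SET]) A o =
    draw j i `&` draw l i.
  apply/seteqP; split => [w Aw|w [Aj Al] o /=].
    by split; [apply: (Aw (Some j)) | apply: (Aw (Some l))];
      rewrite /= !inE eqxx ?orbT.
  by rewrite !inE => /orP[] /eqP ->.
move=> ->; last by move=> o; rewrite !inE => /orP[] /eqP ->; exact: draw_sigma.
have sjl : Some j \notin [set Some l]%SET.
  by rewrite inE; apply: contraNN jl => /eqP[->].
rewrite big_setU1 //= big_set1 /=.
by rewrite !(draws_uniform alg) // expr2 EFinM.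
Qed.

Let freqE k i w : freq (R := R) (M k) (fun j => xi k j w) i =
  (M k)%:R^-1 * \sum_(j < M k) \1_(draw j i : set T) w.
Proof.
congr (_ * _); apply: eq_bigr => j _; rewrite indicE; congr (_%:R).
by congr nat_of_bool; apply/eqP/idP => [/mem_set|/set_mem].
Qed.

Let mfreq k i : (0 < k)%N ->
  measurable_fun [set: T]
    (fun w => `|freq (M k) (fun j => xi k j w) i - n%:R^-1 : R|).
Proof.
move=> k0; under eq_fun do rewrite freqE.
apply: measurableT_comp => //; apply: measurable_funB => //.
apply: measurable_funM => //; apply: measurable_sum => j.
exact/measurable_indic/mdraw.
Qed.

Lemma measurable_noise k : (0 < k)%N ->
  measurable_fun [set: T] (fun w => noise (R := R) (M k) (fun j => xi k j w)).
Proof. by move=> k0; apply: measurable_sum => i; exact: mfreq. Qed.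

(** The batch size satisfies [M^-1 <= t ^+ 2] with [t = (1 - kap) ^+ k.+1], so each of the [n]
    frequencies deviates by at most [t] on average. The weaker exponent [k.-1] suits noise reindexed
    from 0. *)
Lemma integral_noise k : (0 < k)%N ->
  (\int[P]_w (noise (R := R) (M k) (fun j => xi k j w))%:E
    <= (n%:R * (1 - kap) ^+ k.-1)%:E)%E.
Proof.
move=> k0; under eq_integral do rewrite -sumEFin.
rewrite ge0_integral_sum //; last first.
  by move=> i; apply/measurable_EFinP; exact: mfreq.
apply: (@le_trans _ _ (\sum_(i < n) ((1 - kap) ^+ k.+1)%:E)%E).
  apply: lee_sum => i _; under eq_integral do rewrite freqE.
  apply: integral_frequency_deviation; rewrite ?batch_size_gt0 ?exprn_gt0 //.
  - by move=> j; exact: mdraw.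
  - by move=> j; rewrite (draws_uniform alg).
  - by move=> j l; exact: draw_pair.
  rewrite -exprM -[leRHS]invrK lef_pV2 ?posrE ?invr_gt0 ?exprn_gt0 //; last first.
    by rewrite ltr0n batch_size_gt0.
  by rewrite mulSn mulnC addnC -div1r batch_size_ge.
rewrite sumEFin lee_fin sumr_const card_ord -(mulr_natl (_ ^+ _)) ler_wpM2l //.
by rewrite ler_wiXn2l ?(ltW q0) ?gerBl ?(ltW kap0) // (leq_trans (leq_pred k)).
Qed.

End PsfwNoise.

(** * Convergence *)

Section PsfwConvergence.
Context {R : realType} {n m p : nat}.
Variables (C : 'M[R]_(m, p)) (b : 'cV[R]_m).
Variables (f : 'I_n -> 'cV[R]_p -> R) (sigma L : 'I_n -> R) (carath : bool).
Context {disp : measure_display} {T : measurableType disp}.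
Variable Pr : probability T R.
Variables (past : nat -> set (set T)) (xi : nat -> nat -> T -> 'I_n).
Variables (x : nat -> T -> 'cV[R]_p) (mu : nat -> T -> 'cV[R]_p -> R).
Hypothesis n0 : (0 < n)%N.
Hypothesis cP : compact (polyhedron C b).
Hypothesis sc : forall i, strongly_convex (sigma i) (f i).
Hypothesis lg : forall i, lipschitz_gradient (L i) (f i).
Hypothesis alg : psfw C b f sigma L carath Pr past xi x mu.
Local Notation P := (polyhedron C b).
Local Notation V := (vertices C b).
Local Notation kap := (kappa C b sigma L carath).
Local Notation Fs := (Fstar C b f).
Local Notation M := (batch_size C b sigma L carath).

Lemma probability_point : exists w : T, True.
Proof.
apply: contrapT => nT; have := probability_setT Pr.
have -> : [set: T] = set0 by apply/seteqP; split=> // w _; case: nT; exists w.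
by rewrite measure0 => /eqP; rewrite eq_sym onee_eq0.
Qed.

(** The starting iterate at any outcome is a vertex, and an outcome exists because the total
    probability is 1. *)
Lemma exists_vertex : exists v, v \in V.
Proof.
by have [w _] := probability_point; exists (x 1%N w); exact: start_iterate alg w.
Qed.

Lemma start_rep w : convex_rep C b (x 1%N w) (mu 1%N w).
Proof.
have xV := start_iterate alg w.
have muE v : v \in V -> mu 1%N w v = (v == x 1%N w)%:R.
  exact: start_weights alg w v.
split.
- by move=> v vV; rewrite muE.
- rewrite -[RHS](sum_vertex_delta (fun=> 1 : R) xV).
  by apply: eq_big_seq => v vV; rewrite muE //; case: eqP.
- rewrite -[RHS](sum_vertex_delta id xV).
  apply: eq_big_seq => v vV; rewrite muE //.
  by case: eqP => _; rewrite /= ?scale1r ?scale0r.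
Qed.

Lemma strong_convexity_bound : exists2 s : R, 0 < s & forall i, s <= sigma i.
Proof.
have [s s0 sP] := positive_lower_bound (enum 'I_n) sigma.
by exists s => // i; apply: sP; rewrite ?mem_enum //; case: (sc i).
Qed.

Lemma lipschitz_gt0 (y z : 'cV[R]_p) i : y != z -> 0 < L i.
Proof.
move=> yz; have [s0 _] := sc i.
exact: lt_le_trans s0 (strongly_convex_le_lipschitz yz (sc i) (lg i)).
Qed.

Lemma LF_ge i : L i <= LF L.
Proof.
apply: ub_le_sup; last by exists i.
exists (\sum_j `|L j|) => _ [j _ <-].
by apply: le_trans (ler_norm _) _; rewrite (bigD1 j) //= lerDl sumr_ge0.
Qed.

Lemma diameter_gt0 (y z : 'cV[R]_p) : P y -> P z -> y != z -> 0 < diameter P.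
Proof.
move=> Py Pz yz; apply: lt_le_trans (enorm_le_diameter cP Py Pz).
by rewrite enorm_gt0 subr_eq0.
Qed.

(** A nonzero diameter yields two distinct points, which make [Omega], [LF] and the diameter
    positive; zero diameter falls under the convention [kappa = 1 / 2]. *)
Lemma kappa_bounds : 0 < kap <= 1 / 2.
Proof.
have half : 0 < 1 / 2 :> R by rewrite divr_gt0.
rewrite /kappa; case: eqP => [_|/eqP D0]; first by rewrite half lexx.
have [v vV] := exists_vertex.
rewrite ge_min lexx lt_min half /= andbT.
have [[y [z [Py Pz yz]]]|one] :=
    pselect (exists y z, [/\ P y, P z & y != z]); last first.
  case/eqP: D0; rewrite /diameter; apply/eqP; rewrite eq_le; apply/andP; split.
    apply: ge_sup => [|_ [y [z [Py Pz ->]]]].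
      by exists (enorm (v - v)), v, v; split=> //; exact: vertices_sub.
    have -> : y = z by apply: contrapT => /eqP yz; apply: one; exists y, z.
    by rewrite subrr enorm0.
  have Pv := vertices_sub vV.
  by rewrite -(enorm0 (R := R) (p := p)) -(subrr v) enorm_le_diameter.
have Om := Omega_gt0 cP vV Py Pz yz.
have [s s0 ss] := strong_convexity_bound.
pose i0 := Ordinal n0.
have sF : 0 < sigmaF sigma.
  apply: lt_le_trans s0 _; apply: lb_le_inf; first by exists (sigma i0), i0.
  by move=> _ [i _ <-].
have LF0 : 0 < LF L := lt_le_trans (lipschitz_gt0 i0 yz) (LF_ge i0).
have N0 : 0 < (Nrep C b carath)%:R :> R.
  rewrite ltr0n /Nrep; case: carath => //; rewrite cardfs_gt0.
  by apply/fset0Pn; exists v.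
have Dp := diameter_gt0 Py Pz yz.
apply: divr_gt0; first by rewrite mulr_gt0 // exprn_gt0.
apply: mulr_gt0; last exact: exprn_gt0.
by apply: mulr_gt0 => //; apply: mulr_gt0 => //; exact: exprn_gt0.
Qed.

Let kap0 : 0 < kap. Proof. by case/andP: kappa_bounds. Qed.
Let kap1 : kap < 1.
Proof. by case/andP: kappa_bounds => _ /le_lt_trans; apply; lra. Qed.

Lemma Fstar_le_of_lbound y : has_lbound [set F f z | z in P] -> P y ->
  Fs <= F f y.
Proof. by move=> lb Py; apply: ge_inf => //; exists y. Qed.

(** Bounds against all points of the polyhedron pass to the infimum, which takes the place of a
    minimizer. *)
Lemma Fstar_approx z c : (forall y, P y -> F f z - F f y <= c) ->
  F f z - Fs <= c.
Proof.
move=> le_c; rewrite lerBlDr -lerBlDl; apply: lb_le_inf.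
  have [v vV] := exists_vertex; exists (F f v), v => //; exact: vertices_sub.
by move=> _ [y Py <-]; have := le_c y Py; lra.
Qed.

Lemma psfw_decay : exists r c' : R, [/\ 0 < r < 1, 0 <= c',
  (forall k w, 0 <= F f (x k.+1 w) - Fs),
  (forall k, (\int[Pr]_w (F f (x k.+1 w) - Fs)%:E <= (c' * r ^+ k)%:E)%E)
  & {ae Pr, forall w, exists2 Z, 0 <= Z &
      forall k, F f (x k.+1 w) - Fs <= Z * r ^+ k}].
Proof.
have [[y [z [Py Pz yz]]]|one] :=
    pselect (exists y z, [/\ P y, P z & y != z]); last first.
  (* On a single point the iterates never move and [F - Fs] vanishes, so any rate will do; the
     Lipschitz constants need not be positive in this case. *)
  have [v vV] := exists_vertex.
  have eqP1 u u' : P u -> P u' -> u = u'.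
    by move=> Pu Pu'; apply: contrapT => /eqP ne; apply: one; exists u, u'.
  have xP w k : P (x k.+1 w).
    elim: k => [|k IH]; first exact: vertices_sub (start_iterate alg w).
    have [q [u [gam [[qV _] [ua _] _ -> _]]]] := iteration alg w (ltn0Sn k).
    have uV : u \in V by move: ua; rewrite !inE => /andP[].
    by rewrite (eqP1 q u (vertices_sub qV) (vertices_sub uV)) subrr scaler0 addr0.
  have h0 k w : F f (x k.+1 w) - Fs = 0.
    apply: le_anti; apply/andP; split.
      by apply: Fstar_approx => u Pu; rewrite (eqP1 u (x k.+1 w)) // subrr.
    rewrite subr_ge0; apply: Fstar_le_of_lbound => //.
    by exists (F f (x k.+1 w)) => _ [u Pu <-]; rewrite (eqP1 u (x k.+1 w)).
  exists (1 / 2), 0; split=> //; first by lra.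
  - by move=> k w; rewrite h0.
  - move=> k; under eq_integral do rewrite h0.
    by rewrite integral0 mul0r.
  - by apply: aeW => w; exists 0 => // k; rewrite h0 mul0r.
pose D := diameter P; have D0 : 0 < D := diameter_gt0 Py Pz yz.
have diamD u v : P u -> P v -> enorm (u - v) <= D.
  exact: enorm_le_diameter.
have [s s0 ss] := strong_convexity_bound.
have L0 i : 0 < L i <= LF L by rewrite LF_ge (lipschitz_gt0 i yz).
have Lm0 : 0 < LF L by case/andP: (L0 (Ordinal n0)); exact: lt_le_trans.
(* On the polyhedron the gradient of [f i] differs from its value at [y] by at most [L i * D]. *)
pose B := 1 + \sum_i (L i * D + enorm (gradient (f i) y)).
have t0 i : 0 <= L i * D + enorm (gradient (f i) y).
  by rewrite addr_ge0 ?enorm_ge0 // mulr_ge0 ?(ltW D0) // ltW //; case/andP: (L0 i).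
have B0 : 0 < B by rewrite ltr_pwDl // sumr_ge0.
have gradB i u : P u -> enorm (gradient (f i) u) <= B.
  move=> Pu; apply: ler_wpDl => //; rewrite (bigD1 i) //= ler_wpDr ?sumr_ge0 //.
  rewrite -(subrK (gradient (f i) y) (gradient (f i) u)).
  apply: le_trans (enormD _ _) _; rewrite lerD2r.
  have [_ /(_ u y) /le_trans] := lg i; apply.
  by rewrite ler_wpM2l ?diamD // ltW //; case/andP: (L0 i).
have F_diff u v : P u -> P v -> F f u - F f v <= B * D.
  move=> Pu Pv; rewrite F_wavg /wavg -sumrB.
  have -> : B * D = \sum_(i < n) n%:R^-1 * (B * D).
    by rewrite -mulr_suml sum_uniform // mul1r.
  apply: ler_sum => i _; rewrite -mulrBr ler_wpM2l ?invr_ge0 //.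
  apply: le_trans (ler_norm _) _.
  apply: le_trans (component_lipschitz sc lg gradB i Pu Pv) _.
  by rewrite ler_wpM2l ?diamD // ltW.
have lbF : has_lbound [set F f z | z in P].
  by exists (F f y - B * D) => _ [u Pu <-]; have := F_diff y u Py Pu; lra.
have Fs_le u : P u -> Fs <= F f u := Fstar_le_of_lbound lbF.
have [K K0 gapK] := pairwise_gap C b.
have [A [c1 [c2 [c3 [[A0 c10 c20 c30] stepP]]]]] :=
  psfw_progress_constants carath n0 sc lg s0 B0 D0 K0 ss L0 gradB diamD gapK.
pose e k w : R := noise (M k.+1) (fun j => xi k.+1 j w).
have M0 k : (0 < M k)%N := batch_size_gt0 kap1 k.
have rep w k : convex_rep C b (x k.+1 w) (mu k.+1 w).
  elim: k => [|k IH]; first exact: start_rep.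
  by have [] := stepP _ _ _ _ _ _ (M0 k.+1) IH (iteration alg w (ltn0Sn k)).
have stepw w k :=
  stepP _ _ _ _ _ _ (M0 k.+1) (rep w k) (iteration alg w (ltn0Sn k)).
have e0 k w : 0 <= e k w by exact: noise_ge0.
have contr w k := @window_contraction _ _ _ _ C b f L n0 lg Fs (LF L) A c1 c2 c3 D
  Lm0 A0 c10 c20 c30 D0 LF_ge diamD Fs_le Fstar_approx
  (fun k => x k.+1 w) (fun k => mu k.+1 w) (fun k => e k w) (fun k => e0 k w)
  (rep w) (fun k => let: And3 _ i _ := stepw w k in i)
  (fun k => let: And3 _ _ i := stepw w k in i) k.
have th := window_rate_bounds Lm0 c10 c20 c30 D0.
have q0 : 0 < 1 - kap by rewrite subr_gt0.
have q1 : 1 - kap < 1 by rewrite gtrBl.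
(* The recursion is solved for the very ratio [s] of [scaled_sum], taken at [q = 1 - kap]. *)
have [s'0 s'1 _] := half_above q0 q1.
have s'01 : 0 < (1 + (1 - kap)) / 2 < 1 by rewrite s'0.
have A20 : 0 <= 2 * A by rewrite mulr_ge0 // ltW.
have [r [c [d [r01 c0 d0 rec]]]] :=
  window_recursion_decay (ltn0Sn (#|` V| * #|` V|)) th s'01 A20.
have [r0 _] := andP r01.
have h0 k w : 0 <= F f (x k.+1 w) - Fs.
  by rewrite subr_ge0 Fs_le //; exact: convex_rep_mem (rep w k).
have hH k w : F f (x k.+1 w) - Fs <= B * D.
  apply: Fstar_approx => u Pu; rewrite F_diff //.
  exact: convex_rep_mem (rep w k).
have BD0 : 0 <= B * D by rewrite mulr_ge0 // ltW.
have decay w K' : 0 <= K' ->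
    (forall k, e k w <= K' * ((1 + (1 - kap)) / 2) ^+ k) ->
    forall k, F f (x k.+1 w) - Fs <= (c * (B * D) + d * K') * r ^+ k.
  by move=> K'0 eK; apply: (rec (fun k => F f (x k.+1 w) - Fs) (fun k => e k w)).
have me k : measurable_fun [set: T] (e k) by exact: (measurable_noise alg).
have int_e k : (\int[Pr]_w (e k w)%:E <= (n%:R * (1 - kap) ^+ k)%:E)%E.
  exact: (integral_noise alg kap0 kap1 (ltn0Sn k)).
have cBD0 : 0 <= c * (B * D) by rewrite mulr_ge0.
have [c' c'0 exp_dec] :=
  expected_decay e0 me (ler0n R n) q0 q1 int_e h0 cBD0 d0 r0 decay.
exists r, c'; split=> //.
exact: (ae_decay e0 me (ler0n R n) q0 q1 int_e cBD0 d0 decay).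
Qed.

End PsfwConvergence.

(** Writing [r ^+ k] as the power [k / N] of [r ^+ N] fits an arbitrary geometric rate to a
    prescribed denominator [N]. *)
Lemma expr_le_powR (R : realType) (r y : R) (N k : nat) : 0 <= r -> (0 < N)%N ->
  r ^+ N <= y -> r ^+ k <= y `^ (k%:R / N%:R).
Proof.
move=> r0 N0 rNy; have N0' : N%:R != 0 :> R by rewrite pnatr_eq0 -lt0n.
have <- : (r ^+ N) `^ (k%:R / N%:R) = r ^+ k.
  by rewrite -powR_mulrn // -powRrM mulrC divfK // powR_mulrn.
apply: ge0_ler_powR; rewrite ?nnegrE ?divr_ge0 ?exprn_ge0 //.
by rewrite (le_trans _ rNy) // exprn_ge0.
Qed.

(** * Limits deduced from a geometric bound *)

Section GeometricTail.
Context {R : realType}.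
Variables (h : nat -> R) (r Z : R).
Hypotheses (r0 : 0 < r) (r1 : r < 1) (Z0 : 0 <= Z).
Hypotheses (h0 : forall k, 0 <= h k.+1) (hZ : forall k, h k.+1 <= Z * r ^+ k).

(** The shift of index costs the factor [1 / r]; the value at 0 is uncontrolled, so the limits below
    look only at [k > 0]. *)
Let hr k : (0 < k)%N -> 0 <= h k <= Z / r * r ^+ k.
Proof.
case: k => // k _; rewrite h0 /= (le_trans (hZ k)) //.
by rewrite exprS -mulrA mulKf // gt_eqF.
Qed.

(** The ratio is squeezed below a geometric sequence of ratio [t], the [N]-th root of [y / z]. *)
Lemma cvg_ratio_powR (y z : R) (N : nat) : (0 < N)%N -> r ^+ N <= y -> y < z ->
  h k / z `^ (k%:R / N%:R) @[k --> \oo] --> (0 : R).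
Proof.
move=> N0 ry yz; have y0 : 0 < y by apply: lt_le_trans ry; rewrite exprn_gt0.
have z0 : 0 < z := lt_trans y0 yz.
have yz0 : 0 < y / z by rewrite divr_gt0.
pose t := (y / z) `^ (N%:R^-1).
have t0 : 0 < t by rewrite powR_gt0.
have tN : t ^+ N = y / z.
  by rewrite -powR_mulrn ?ltW // -powRrM mulVf ?pnatr_eq0 -?lt0n // powRr1 // ltW.
have t1 : t < 1.
  rewrite ltNge; apply/negP => t1; have := exprn_ege1 N t1.
  by rewrite tN ler_pdivlMr // mul1r leNgt yz.
have tE k : y `^ (k%:R / N%:R) = t ^+ k * z `^ (k%:R / N%:R).
  rewrite -{1}(divfK (lt0r_neq0 z0) y) powRM ?ltW //.
  by rewrite -powR_mulrn ?(ltW t0) // -powRrM [_^-1 * _]mulrC.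
have c0 : geometric (Z / r) t k @[k --> \oo] --> (0 : R).
  by apply: cvg_geometric; rewrite ger0_norm // ltW.
apply: (squeeze_cvgr _ (cvg_cst 0) c0).
near=> k; have k0 : (0 < k)%N by near: k; exact: nbhs_infty_gt.
have zk : 0 < z `^ (k%:R / N%:R) by rewrite powR_gt0.
have /andP[hk0 hk] := hr k0.
rewrite divr_ge0 ?(ltW zk) //= ler_pdivrMr // -mulrA -tE.
apply: le_trans hk _; rewrite ler_wpM2l ?divr_ge0 ?(ltW r0) //.
by apply: expr_le_powR => //; exact: ltW.
Unshelve. all: by end_near. Qed.

Lemma littleo_geometric (s : R) : r < s -> h =o_\oo (fun k => s ^+ k : R).
Proof.
move=> rs; have s0 : 0 < s := lt_trans r0 rs.
have rs1 : `|r / s| < 1.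
  by rewrite ger0_norm ?divr_ge0 ?ltW // ltr_pdivrMr // mul1r.
apply/eqoP => eps eps0; near=> k.
have k0 : (0 < k)%N by near: k; exact: nbhs_infty_gt.
have /andP[hk0 hk] := hr k0.
rewrite !ger0_norm ?exprn_ge0 ?(ltW s0) //; apply: le_trans hk _.
have : geometric (Z / r) (r / s) k <= eps.
  by near: k; exact: (cvgr_le _ (cvg_geometric (Z / r) rs1)).
by rewrite /= expr_div_n mulrA ler_pdivrMr // exprn_gt0.
Unshelve. all: by end_near. Qed.

End GeometricTail.

Theorem corollary4 (R : realType) (n m p : nat)
    (C : 'M[R]_(m, p)) (b : 'cV[R]_m)
    (f : 'I_n -> 'cV[R]_p -> R) (sigma L : 'I_n -> R) (carath : bool)
    (disp : measure_display) (T : measurableType disp) (P : probability T R)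
    (past : nat -> set (set T)) (xi : nat -> nat -> T -> 'I_n)
    (x : nat -> T -> 'cV[R]_p) (mu : nat -> T -> 'cV[R]_p -> R) :
  (0 < n)%N ->
  polyhedron C b !=set0 ->
  compact (polyhedron C b) ->
  (forall i, strongly_convex (sigma i) (f i)) ->
  (forall i, lipschitz_gradient (L i) (f i)) ->
  psfw C b f sigma L carath P past xi x mu ->
  let kap := kappa C b sigma L carath in
  let rate (k : nat) : R := k%:R / (3 * (#|` vertices C b |)`! + 1)%:R in
  (exists C3 phi : R,
    [/\ 0 < phi < kap,
        kap <= 1 / 2,
        (forall k : nat, (1 <= k)%N ->
          ('E_P[fun w => (F f (x k.+1 w) - Fstar C b f)%R]
             <= (C3 * (1 - phi) `^ rate k)%:E)%E)
      & exists2 psi : R, 0 < psi < phi &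
          {ae P, forall w,
            (F f (x k w) - Fstar C b f) / (1 - psi) `^ rate k
              @[k --> \oo] --> (0 : R)}]) /\
  as_linear_convergence P (fun k w => F f (x k w)) (Fstar C b f).
Proof.
move=> n0 P0 cP sc lg alg kap rate.
have /andP[kap0 kap2] : 0 < kap <= 1 / 2 := kappa_bounds n0 cP sc lg alg.
have [r [c [/andP[r0 r1] c0 h0 hE hae]]] := psfw_decay n0 cP sc lg alg.
pose N := (3 * (#|` vertices C b |)`! + 1)%N.
have N0 : (0 < N)%N by rewrite /N addn1.
(* The first term gives [phi < kap]; the second gives [r ^+ N <= 1 - phi], that is, the claimed rate
   is no faster than [r]. *)
pose phi := Num.min (kap / 2) (1 - r ^+ N).
have phi0 : 0 < phi.
  by rewrite lt_min divr_gt0 // subr_gt0 exprn_ilt1 // ?ltW // -lt0n.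
have phik : phi < kap.
  by rewrite gt_min ltr_pdivrMr // ltr_pMr // ltrDl ltr01.
have rphi : r ^+ N <= 1 - phi.
  by rewrite lerBrDr -lerBrDl ge_min lexx orbT.
split.
  exists c, phi; split=> //; first by rewrite phi0.
    move=> k _; rewrite expectation.unlock; apply: le_trans (hE k) _.
    by rewrite lee_fin ler_wpM2l // expr_le_powR // ltW.
  (* Halving [phi] makes [1 - psi] strictly larger than [1 - phi], so the ratio tends to 0. *)
  exists (phi / 2); first by rewrite divr_gt0 //= ltr_pdivrMr // ltr_pMr // ltrDl.
  apply: filterS hae => w [Z Z0 hZ].
  apply: (cvg_ratio_powR r0 Z0 (fun k => h0 k w) hZ N0 rphi).
  by rewrite ltrD2l ltrN2 ltr_pdivrMr // ltr_pMr // ltrDl.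
have [s0 s1 rs] := half_above r0 r1.
exists ((1 + r) / 2); split; first by rewrite s0.
apply: filterS hae => w [Z Z0 hZ].
exact: (@littleo_geometric _ (fun k => F f (x k w) - Fstar C b f) r Z r0
  (fun k => h0 k w) hZ _ rs).
Qed.
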